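(* Let $F$ be a field of arbitrary characteristic and let $\varphi$ be a nondegenerate ternary quadratic form over $F$. Then the alternative Clifford algebra $\operatorname{C}^{\operatorname{alt}}(\varphi)$ has a central localization all of whose simple quotients are octonion algebras.
   Context: A nonassociative ring $A$ is alternative if $(a,a,b)=(a,b,b)=0$ for all $a,b\in A$, where $(x,y,z)=(xy)z-x(yz)$ is the associator. The center of $A$ is the set of $a\in A$ with $(a,A,A)=(A,a,A)=(A,A,a)=0$ and $ax=xa$ for all $x\in A$. A central localization of $A$ is a localization $S^{-1}A$ at a multiplicative set $S$ of nonzero central elements. For a quadratic form $\varphi$ on a finite-dimensional $F$-vector space $V$, write $\varphi(v,w)=\varphi(v+w)-\varphi(v)-\varphi(w)$ for its symmetric bilinear form. The form is nondegenerate if the radical of this bilinear form has dimension at most $1$ and $\varphi(x)\neq 0$ for every nonzero $x$ in the radical. Ternary means $\dim_F V=3$. The alternative Clifford algebra $\operatorname{C}^{\operatorname{alt}}(\varphi)$ is the alternative tensor algebra of $V$ modulo the relations $v^2=\varphi(v)\cdot 1$ for all $v\in V$; explicitly, it is the free (unital) alternative $F$-algebra generated by $x_1,\dots,x_n$ (a basis of $V$) modulo the relations $(u_1x_1+\cdots+u_nx_n)^2=\varphi(u_1,\dots,u_n)$ for all $u_1,\dots,u_n\in F$. An octonion algebra over a field $K$ is the Cayley--Dickson double $(Q,\gamma)_K=Q\oplus Qz$ of a quaternion algebra $Q$ over $K$ with $z^2=\gamma\in K^\times$. The paper calls an algebra whose simple quotients are all octonion algebras (over fields) ``alternative Azumaya''.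 *)

(* Defs.v *)
From HB Require Import structures.
From mathcomp Require Import all_boot all_order all_algebra all_field.
From mathcomp Require Import generic_quotient ring_quotient.
From mathcomp Require Import boolp.
Set Implicit Arguments.
Unset Strict Implicit.
Unset Printing Implicit Defensive.
Import GRing.Theory.
Local Open Scope ring_scope.
Local Open Scope quotient_scope.

HB.mixin Record Zmodule_isNARing R of GRing.Zmodule R := {
  naone : R;
  namul : R -> R -> R;
  namul1r : left_id naone namul;
  namulr1 : right_id naone namul;
  namulDl : left_distributive namul +%R;
  namulDr : right_distributive namul +%R
}.

#[short(type="naRingType")]
HB.structure Definition NARing := {R of GRing.Zmodule R & Zmodule_isNARing R}.

Notation "x ** y" := (namul x y) (at level 40, left associativity) : ring_scope.

HB.mixin Record NARing_isNAAlgebra (F : fieldType) A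
    of GRing.Lmodule F A & NARing A := {
  nascalerAl : forall (a : F) (x y : A), a *: (x ** y) = (a *: x) ** y;
  nascalerAr : forall (a : F) (x y : A), a *: (x ** y) = x ** (a *: y)
}.

#[short(type="naAlgType")]
HB.structure Definition NAAlgebra (F : fieldType) :=
  {A of GRing.Lmodule F A & NARing A & NARing_isNAAlgebra F A}.

Section Theory.
Variable R : naRingType.
Implicit Types (x y z a : R).

Lemma namul0r x : 0 ** x = 0.
Proof. by apply: (addrI (0 ** x)); rewrite -namulDl !addr0. Qed.

Lemma namulr0 x : x ** 0 = 0.
Proof. by apply: (addrI (x ** 0)); rewrite -namulDr !addr0. Qed.

Lemma namulrN x y : x ** (- y) = - (x ** y).
Proof. by apply: (addrI (x ** y)); rewrite -namulDr !subrr namulr0. Qed.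

Lemma namulNr x y : (- x) ** y = - (x ** y).
Proof. by apply: (addrI (x ** y)); rewrite -namulDl !subrr namul0r. Qed.

Definition associator x y z := (x ** y) ** z - x ** (y ** z).

Definition na_central a :=
  [/\ forall x y, associator a x y = 0,
      forall x y, associator x a y = 0,
      forall x y, associator x y a = 0 &
      forall x, a ** x = x ** a].

End Theory.

Definition na_alternative (R : naRingType) :=
  forall a b : R, associator a a b = 0 /\ associator a b b = 0.

Definition na_morphism (R R' : naRingType) (f : R -> R') :=
  [/\ {morph f : x y / x + y}, {morph f : x y / x ** y} & f naone = naone].

HB.mixin Record isNAIdeal (R : naRingType) (I : R -> bool) := {
  naidealMl : forall x y : R, y \in I -> x ** y \in I;
  naidealMr : forall x y : R, x \in I -> x ** y \in I
}.

(* The whole ring is allowed as an ideal. *)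
#[short(type="naIdeal")]
HB.structure Definition NAIdeal (R : naRingType) :=
  {I of GRing.ZmodClosed R I & isNAIdeal R I}.

Definition naquot (R : naRingType) (I : naIdeal R) : Type := Quotient.quot I.

Section Quot.
Variables (R : naRingType) (I : naIdeal R).
Local Notation Q := (naquot I).

HB.instance Definition _ := GRing.Zmodule.on Q.

Definition to_naquot (x : R) : Q := \pi_(Quotient.quot I) x.
Definition naquot_one : Q := to_naquot naone.
Definition naquot_mul (p q : Q) : Q :=
  to_naquot (repr (p : Quotient.quot I) ** repr (q : Quotient.quot I)).

Lemma to_naquot_eqP x y : (to_naquot x = to_naquot y) <-> (x - y \in I).
Proof. by rewrite Quotient.idealrBE; split=> /eqP. Qed.

Lemma to_naquotP (P : Q -> Prop) : (forall x, P (to_naquot x)) -> forall p, P p.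
Proof. by move=> h p; rewrite -[p](@reprK _ (Quotient.quot I)); apply: h. Qed.

Lemma to_naquotD : {morph to_naquot : x y / x + y}.
Proof. by move=> x y; rewrite /to_naquot !piE. Qed.

Lemma naquot_mulE x y :
  naquot_mul (to_naquot x) (to_naquot y) = to_naquot (x ** y).
Proof.
rewrite /naquot_mul; set x' := repr _; set y' := repr _; apply/to_naquot_eqP.
have hx : x' - x \in I by apply/to_naquot_eqP; exact: reprK.
have hy : y' - y \in I by apply/to_naquot_eqP; exact: reprK.
have -> : x' ** y' - x ** y = x' ** (y' - y) + (x' - x) ** y.
  by rewrite namulDr namulDl namulrN namulNr addrA subrK.
by apply: rpredD; [exact: naidealMl | exact: naidealMr].
Qed.

Fact naquot_mul1r : left_id naquot_one naquot_mul.
Proof. by elim/to_naquotP=> x; rewrite naquot_mulE namul1r. Qed.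
Fact naquot_mulr1 : right_id naquot_one naquot_mul.
Proof. by elim/to_naquotP=> x; rewrite naquot_mulE namulr1. Qed.
Fact naquot_mulDl : left_distributive naquot_mul +%R.
Proof.
elim/to_naquotP=> x; elim/to_naquotP=> y; elim/to_naquotP=> z.
by rewrite -to_naquotD !naquot_mulE namulDl to_naquotD.
Qed.
Fact naquot_mulDr : right_distributive naquot_mul +%R.
Proof.
elim/to_naquotP=> x; elim/to_naquotP=> y; elim/to_naquotP=> z.
by rewrite -to_naquotD !naquot_mulE namulDr to_naquotD.
Qed.

HB.instance Definition _ := Zmodule_isNARing.Build Q
  naquot_mul1r naquot_mulr1 naquot_mulDl naquot_mulDr.

Lemma to_naquot_morphism : na_morphism to_naquot.
Proof. by split=> // [|x y]; [exact: to_naquotD | rewrite -naquot_mulE]. Qed.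

End Quot.

Definition na_simple (R : naRingType) : Prop :=
  naone != 0 :> R /\
  forall I : naIdeal R, (forall x, x \in I -> x = 0) \/ (forall x, x \in I).

Record centralMulSet (R : naRingType) := CentralMulSet {
  cms_pred :> {pred R};
  cms_one : naone \in cms_pred;
  cms_mul : {in cms_pred &, forall s t, s ** t \in cms_pred};
  cms_central : {in cms_pred, forall s, na_central s};
  cms_neq0 : {in cms_pred, forall s, s != 0}
}.

Section Localization.
Variables (R : naRingType) (S : centralMulSet R).

Definition denom : Type := {s : R | s \in (S : {pred R})}.
HB.instance Definition _ := Choice.on denom.

Definition denom1 : denom := exist _ naone (cms_one S).
Definition denom_mul (s t : denom) : denom :=
  exist _ (sval s ** sval t) (cms_mul (svalP s) (svalP t)).

(* (a, s) stands for the fraction s^-1 a. *)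
Definition prefrac : Type := (R * denom)%type.
HB.instance Definition _ := Choice.on prefrac.

Implicit Types (x y z : prefrac) (s t u : denom) (a b c : R).

Definition sc s a : R := sval s ** a.

(* S may contain zero divisors, hence the extra factor u. *)
Definition frac_rel x y : bool :=
  `[< exists u, sc u (sc y.2 x.1) = sc u (sc x.2 y.1) >].

Lemma sc1 a : sc denom1 a = a. Proof. exact: namul1r. Qed.
Lemma scD s a b : sc s (a + b) = sc s a + sc s b. Proof. exact: namulDr. Qed.
Lemma scN s a : sc s (- a) = - sc s a. Proof. exact: namulrN. Qed.
Lemma sc0 s : sc s 0 = 0. Proof. exact: namulr0. Qed.

Lemma scMl s a b : sc s a ** b = sc s (a ** b).
Proof.
by case: (cms_central (svalP s)) => h _ _ _; apply/eqP; rewrite -subr_eq0 -(h a b).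
Qed.

Lemma scMr s a b : a ** sc s b = sc s (a ** b).
Proof.
case: (cms_central (svalP s)) => h1 h2 h3 h4; rewrite /sc.
rewrite [sval s ** b]h4 [sval s ** (a ** b)]h4.
by apply/esym/eqP; rewrite -subr_eq0 -(h3 a b).
Qed.

Lemma sc_mul s t a : sc (denom_mul s t) a = sc s (sc t a).
Proof. exact: scMl. Qed.

Lemma scC s t a : sc s (sc t a) = sc t (sc s a).
Proof. exact: scMr. Qed.

Lemma denom_mulC : commutative denom_mul.
Proof.
by move=> s t; apply: val_inj; case: (cms_central (svalP s)) => _ _ _; apply.
Qed.

Lemma denom_mulA : associative denom_mul.
Proof. by move=> s t u; apply: val_inj; rewrite /= -[LHS]scMl. Qed.

Lemma denom_mul1 : left_id denom1 denom_mul.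
Proof. by move=> s; apply: val_inj; exact: namul1r. Qed.

HB.instance Definition _ :=
  Monoid.isComLaw.Build denom denom1 denom_mul denom_mulA denom_mulC denom_mul1.

Fact frac_rel_refl : reflexive frac_rel.
Proof. by move=> x; apply/asboolP; exists denom1. Qed.

Fact frac_rel_sym : symmetric frac_rel.
Proof. by move=> x y; apply/asboolP/asboolP=> -[u h]; exists u. Qed.

Fact frac_rel_trans : transitive frac_rel.
Proof.
move=> [b t] [a s] [c r] /asboolP[u /= h] /asboolP[v /= k]; apply/asboolP.
exists (denom_mul t (denom_mul u v)) => /=; rewrite -!sc_mul in h k *.
transitivity (sc (denom_mul v r) (sc (denom_mul u t) a)).
  by rewrite -sc_mul; congr (sc _ a); rewrite (AC (1*2*1) ((3*4)*(2*1))).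
rewrite h -sc_mul; transitivity (sc (denom_mul u s) (sc (denom_mul v r) b)).
  by rewrite -sc_mul; congr (sc _ b); rewrite denom_mulC.
by rewrite k -sc_mul; congr (sc _ c); rewrite (AC (2*2) ((4*(1*3))*2)).
Qed.

Canonical frac_equiv :=
  EquivRel frac_rel frac_rel_refl frac_rel_sym frac_rel_trans.

Definition localization : Type := {eq_quot frac_rel}.
Local Notation L := localization.

HB.instance Definition _ := Choice.on L.

Definition to_loc x : L := \pi_({eq_quot frac_rel}) x.
Definition of_loc (p : L) : prefrac := repr (p : {eq_quot frac_rel}).

Definition loc_zero : L := to_loc (0, denom1).
Definition loc_one : L := to_loc (naone, denom1).
Definition loc_opp (p : L) : L :=
  let: (a, s) := of_loc p in to_loc (- a, s).
Definition loc_add (p q : L) : L :=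
  let: (a, s) := of_loc p in let: (b, t) := of_loc q in
  to_loc (sc t a + sc s b, denom_mul s t).
Definition loc_mul (p q : L) : L :=
  let: (a, s) := of_loc p in let: (b, t) := of_loc q in
  to_loc (a ** b, denom_mul s t).

Lemma to_loc_eqP x y : to_loc x = to_loc y <->
  exists u, sc u (sc y.2 x.1) = sc u (sc x.2 y.1).
Proof.
by split=> [/eqmodP/asboolP|h] //; apply/eqmodP/asboolP.
Qed.

Lemma to_locP (P : L -> Prop) : (forall a s, P (to_loc (a, s))) -> forall p, P p.
Proof.
move=> h p; rewrite -[p](@reprK _ {eq_quot frac_rel}); case: (repr _) => a s.
exact: h.
Qed.

Lemma of_locK p : to_loc (of_loc p) = p. Proof. exact: reprK. Qed.

Lemma loc_oppE a s : loc_opp (to_loc (a, s)) = to_loc (- a, s).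
Proof.
rewrite /loc_opp; case E: (of_loc _) => [a' s'].
move: (of_locK (to_loc (a, s))); rewrite E => /to_loc_eqP[u /= h].
by apply/to_loc_eqP; exists u; rewrite /= !scN h.
Qed.

Lemma loc_addE a s b t : loc_add (to_loc (a, s)) (to_loc (b, t)) =
  to_loc (sc t a + sc s b, denom_mul s t).
Proof.
rewrite /loc_add; case E: (of_loc _) => [a' s'].
move: (of_locK (to_loc (a, s))); rewrite E => /to_loc_eqP[u /= h].
case E': (of_loc _) => [b' t'].
move: (of_locK (to_loc (b, t))); rewrite E' => /to_loc_eqP[v /= k].
apply/to_loc_eqP; exists (denom_mul u v) => /=; rewrite !scD.
rewrite -!sc_mul in h k *; congr (_ + _).
  transitivity (sc (denom_mul v (denom_mul t t')) (sc (denom_mul u s) a')).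
    by rewrite -sc_mul; congr (sc _ a'); rewrite (AC (2*2*1) ((2*(4*5))*(1*3))).
  by rewrite h -sc_mul; congr (sc _ a); rewrite (AC ((1*2)*2) (((4*1)*(5*3))*2)).
transitivity (sc (denom_mul u (denom_mul s s')) (sc (denom_mul v t) b')).
  by rewrite -sc_mul; congr (sc _ b'); rewrite (AC (2*2*1) ((1*(3*5))*(2*4))).
by rewrite k -sc_mul; congr (sc _ b); rewrite (AC ((1*2)*2) (((1*4)*(3*5))*2)).
Qed.

Lemma loc_mulE a s b t : loc_mul (to_loc (a, s)) (to_loc (b, t)) =
  to_loc (a ** b, denom_mul s t).
Proof.
rewrite /loc_mul; case E: (of_loc _) => [a' s'].
move: (of_locK (to_loc (a, s))); rewrite E => /to_loc_eqP[u /= h].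
case E': (of_loc _) => [b' t'].
move: (of_locK (to_loc (b, t))); rewrite E' => /to_loc_eqP[v /= k].
apply/to_loc_eqP; exists (denom_mul u v) => /=.
rewrite -!sc_mul in h k *.
transitivity (sc (denom_mul u s) a' ** sc (denom_mul v t) b').
  rewrite scMl scMr -sc_mul; congr (sc _ _).
  by rewrite (AC (2*2) ((1*3)*(2*4))).
rewrite h k scMl scMr -sc_mul; congr (sc _ _).
by rewrite (AC (2*2) ((1*3)*(2*4))).
Qed.

Fact loc_addA : associative loc_add.
Proof.
elim/to_locP=> a s; elim/to_locP=> b t; elim/to_locP=> c r.
rewrite !loc_addE !scD addrA denom_mulA -!sc_mul.
by congr (to_loc (sc _ a + sc _ b + _, _)); rewrite denom_mulC.
Qed.

Fact loc_addC : commutative loc_add.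
Proof.
elim/to_locP=> a s; elim/to_locP=> b t.
by rewrite !loc_addE addrC denom_mulC.
Qed.

Fact loc_add0 : left_id loc_zero loc_add.
Proof. by elim/to_locP=> a s; rewrite loc_addE sc0 sc1 add0r denom_mul1. Qed.

Fact loc_addN : left_inverse loc_zero loc_opp loc_add.
Proof.
elim/to_locP=> a s; rewrite loc_oppE loc_addE -scD addNr.
by apply/to_loc_eqP; exists denom1; rewrite /= !sc0.
Qed.

HB.instance Definition _ :=
  GRing.isZmodule.Build L loc_addA loc_addC loc_add0 loc_addN.

Fact loc_mul1r : left_id loc_one loc_mul.
Proof. by elim/to_locP=> a s; rewrite loc_mulE namul1r denom_mul1. Qed.

Fact loc_mulr1 : right_id loc_one loc_mul.
Proof.
by elim/to_locP=> a s; rewrite loc_mulE namulr1 denom_mulC denom_mul1.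
Qed.

Fact loc_mulDl : left_distributive loc_mul +%R.
Proof.
elim/to_locP=> a s; elim/to_locP=> b t; elim/to_locP=> c r.
rewrite /GRing.add /= !(loc_addE, loc_mulE) namulDl !scMl.
apply/to_loc_eqP; exists denom1; rewrite !sc1 /= !scD -!sc_mul.
congr (sc _ _ + sc _ _).
  by rewrite (AC (2*2*1) (((1*3)*2)*(5*4))).
by rewrite (AC (2*2*1) (((1*3)*2)*(5*4))).
Qed.

Fact loc_mulDr : right_distributive loc_mul +%R.
Proof.
elim/to_locP=> a s; elim/to_locP=> b t; elim/to_locP=> c r.
rewrite /GRing.add /= !(loc_addE, loc_mulE) namulDr !scMr.
apply/to_loc_eqP; exists denom1; rewrite !sc1 /= !scD -!sc_mul.
congr (sc _ _ + sc _ _).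
  by rewrite (AC (2*2*1) ((1*(2*5))*(3*4))).
by rewrite (AC (2*2*1) ((1*(2*4))*(3*5))).
Qed.

HB.instance Definition _ := Zmodule_isNARing.Build L
  loc_mul1r loc_mulr1 loc_mulDl loc_mulDr.

End Localization.

Section QuadraticForm.
Variables (F : fieldType) (V : vectType F) (phi : V -> F).

Definition polar (v w : V) : F := phi (v + w) - phi v - phi w.

Definition quadratic_form : Prop :=
  (forall a v, phi (a *: v) = a ^+ 2 * phi v) /\
  (forall w, scalar (polar^~ w)).

(* The radical of the polar form of a quadratic form is the only such U. *)
Definition is_radical (U : {vspace V}) : Prop :=
  forall v, v \in U <-> forall w, polar v w = 0.

Definition nondegenerate_form : Prop :=
  exists2 U : {vspace V}, is_radical U &
    (\dim U <= 1)%N /\ (forall v, v \in U -> v != 0 -> phi v != 0).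

End QuadraticForm.

Section AltClifford.
Variables (F : fieldType) (V : vectType F) (phi : V -> F).

Inductive cterm : Type :=
| CGen of V
| CZero
| COne
| CAdd of cterm & cterm
| COpp of cterm
| CMul of cterm & cterm
| CScale of F & cterm.

HB.instance Definition _ := gen_eqMixin cterm.
HB.instance Definition _ := gen_choiceMixin cterm.

(* The least congruence for which the quotient is a unital alternative
   F-algebra, CGen is linear and the square of CGen v is phi v. *)
Inductive crel : cterm -> cterm -> Prop :=
| crel_refl x : crel x x
| crel_sym x y : crel x y -> crel y x
| crel_trans x y z : crel x y -> crel y z -> crel x z
| crel_congAdd x x' y y' :
    crel x x' -> crel y y' -> crel (CAdd x y) (CAdd x' y')
| crel_congOpp x x' : crel x x' -> crel (COpp x) (COpp x')
| crel_congMul x x' y y' :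
    crel x x' -> crel y y' -> crel (CMul x y) (CMul x' y')
| crel_congScale a x x' : crel x x' -> crel (CScale a x) (CScale a x')
| crel_addA x y z : crel (CAdd x (CAdd y z)) (CAdd (CAdd x y) z)
| crel_addC x y : crel (CAdd x y) (CAdd y x)
| crel_add0 x : crel (CAdd CZero x) x
| crel_addN x : crel (CAdd (COpp x) x) CZero
| crel_scaleA a b x : crel (CScale a (CScale b x)) (CScale (a * b) x)
| crel_scale1 x : crel (CScale 1 x) x
| crel_scaleDr a x y :
    crel (CScale a (CAdd x y)) (CAdd (CScale a x) (CScale a y))
| crel_scaleDl a b x :
    crel (CScale (a + b) x) (CAdd (CScale a x) (CScale b x))
| crel_mul1r x : crel (CMul COne x) x
| crel_mulr1 x : crel (CMul x COne) x
| crel_mulDl x y z : crel (CMul (CAdd x y) z) (CAdd (CMul x z) (CMul y z))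
| crel_mulDr x y z : crel (CMul x (CAdd y z)) (CAdd (CMul x y) (CMul x z))
| crel_scaleAl a x y : crel (CScale a (CMul x y)) (CMul (CScale a x) y)
| crel_scaleAr a x y : crel (CScale a (CMul x y)) (CMul x (CScale a y))
| crel_altl x y : crel (CMul (CMul x x) y) (CMul x (CMul x y))
| crel_altr x y : crel (CMul (CMul x y) y) (CMul x (CMul y y))
| crel_genD v w : crel (CGen (v + w)) (CAdd (CGen v) (CGen w))
| crel_genZ a v : crel (CGen (a *: v)) (CScale a (CGen v))
| crel_sq v : crel (CMul (CGen v) (CGen v)) (CScale (phi v) COne).

Definition crelb (x y : cterm) : bool := `[< crel x y >].

Fact crelb_refl : reflexive crelb.
Proof. by move=> x; apply/asboolP; exact: crel_refl. Qed.
Fact crelb_sym : symmetric crelb.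
Proof. by move=> x y; apply/asboolP/asboolP; exact: crel_sym. Qed.
Fact crelb_trans : transitive crelb.
Proof.
by move=> y x z /asboolP h /asboolP k; apply/asboolP; exact: crel_trans h k.
Qed.

Canonical crelb_equiv := EquivRel crelb crelb_refl crelb_sym crelb_trans.

Definition altClifford : Type := {eq_quot crelb}.
Local Notation C := altClifford.

HB.instance Definition _ := Choice.on C.

Definition to_calt (x : cterm) : C := \pi_({eq_quot crelb}) x.
Definition of_calt (p : C) : cterm := repr (p : {eq_quot crelb}).

Lemma to_calt_eqP x y : to_calt x = to_calt y <-> crel x y.
Proof. by split=> [/eqmodP/asboolP|h] //; apply/eqmodP/asboolP. Qed.

Lemma of_caltK p : to_calt (of_calt p) = p. Proof. exact: reprK. Qed.

Lemma to_caltP (P : C -> Prop) : (forall x, P (to_calt x)) -> forall p, P p.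
Proof. by move=> h p; rewrite -[p]of_caltK. Qed.

Lemma of_calt_rel x : crel (of_calt (to_calt x)) x.
Proof. by apply/to_calt_eqP; exact: of_caltK. Qed.

Definition calt_zero : C := to_calt CZero.
Definition calt_one : C := to_calt COne.
Definition calt_opp (p : C) : C := to_calt (COpp (of_calt p)).
Definition calt_add (p q : C) : C := to_calt (CAdd (of_calt p) (of_calt q)).
Definition calt_mul (p q : C) : C := to_calt (CMul (of_calt p) (of_calt q)).
Definition calt_scale (a : F) (p : C) : C := to_calt (CScale a (of_calt p)).
Definition calt_gen (v : V) : C := to_calt (CGen v).

Lemma calt_oppE x : calt_opp (to_calt x) = to_calt (COpp x).
Proof. by apply/to_calt_eqP/crel_congOpp/of_calt_rel. Qed.
Lemma calt_addE x y : calt_add (to_calt x) (to_calt y) = to_calt (CAdd x y).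
Proof. by apply/to_calt_eqP/crel_congAdd; exact: of_calt_rel. Qed.
Lemma calt_mulE x y : calt_mul (to_calt x) (to_calt y) = to_calt (CMul x y).
Proof. by apply/to_calt_eqP/crel_congMul; exact: of_calt_rel. Qed.
Lemma calt_scaleE a x : calt_scale a (to_calt x) = to_calt (CScale a x).
Proof. by apply/to_calt_eqP/crel_congScale/of_calt_rel. Qed.

Let caltE := (calt_oppE, calt_addE, calt_mulE, calt_scaleE).

Fact calt_addA : associative calt_add.
Proof.
elim/to_caltP=> x; elim/to_caltP=> y; elim/to_caltP=> z; rewrite !caltE.
by apply/to_calt_eqP; constructor.
Qed.
Fact calt_addC : commutative calt_add.
Proof.
elim/to_caltP=> x; elim/to_caltP=> y; rewrite !caltE.
by apply/to_calt_eqP; exact: crel_addC.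
Qed.
Fact calt_add0 : left_id calt_zero calt_add.
Proof.
by elim/to_caltP=> x; rewrite !caltE; apply/to_calt_eqP; exact: crel_add0.
Qed.
Fact calt_addN : left_inverse calt_zero calt_opp calt_add.
Proof.
by elim/to_caltP=> x; rewrite !caltE; apply/to_calt_eqP; exact: crel_addN.
Qed.

HB.instance Definition _ :=
  GRing.isZmodule.Build C calt_addA calt_addC calt_add0 calt_addN.

Fact calt_scaleA a b p : calt_scale a (calt_scale b p) = calt_scale (a * b) p.
Proof.
elim/to_caltP: p => x; rewrite !caltE.
by apply/to_calt_eqP; exact: crel_scaleA.
Qed.
Fact calt_scale1 : left_id 1 calt_scale.
Proof.
by elim/to_caltP=> x; rewrite !caltE; apply/to_calt_eqP; exact: crel_scale1.
Qed.
Fact calt_scaleDr : right_distributive calt_scale +%R.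
Proof.
move=> a; elim/to_caltP=> x; elim/to_caltP=> y.
by rewrite /GRing.add /= !caltE; apply/to_calt_eqP; exact: crel_scaleDr.
Qed.
Fact calt_scaleDl p : {morph calt_scale^~ p : a b / a + b}.
Proof.
move=> a b; elim/to_caltP: p => x.
rewrite [RHS]/GRing.add /= !caltE.
by apply/to_calt_eqP; exact: crel_scaleDl.
Qed.

HB.instance Definition _ := GRing.Zmodule_isLmodule.Build F C
  calt_scaleA calt_scale1 calt_scaleDr calt_scaleDl.

Fact calt_mul1r : left_id calt_one calt_mul.
Proof.
by elim/to_caltP=> x; rewrite !caltE; apply/to_calt_eqP; exact: crel_mul1r.
Qed.
Fact calt_mulr1 : right_id calt_one calt_mul.
Proof.
by elim/to_caltP=> x; rewrite !caltE; apply/to_calt_eqP; exact: crel_mulr1.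
Qed.
Fact calt_mulDl : left_distributive calt_mul +%R.
Proof.
elim/to_caltP=> x; elim/to_caltP=> y; elim/to_caltP=> z.
by rewrite /GRing.add /= !caltE; apply/to_calt_eqP; exact: crel_mulDl.
Qed.
Fact calt_mulDr : right_distributive calt_mul +%R.
Proof.
elim/to_caltP=> x; elim/to_caltP=> y; elim/to_caltP=> z.
by rewrite /GRing.add /= !caltE; apply/to_calt_eqP; exact: crel_mulDr.
Qed.

HB.instance Definition _ := Zmodule_isNARing.Build C
  calt_mul1r calt_mulr1 calt_mulDl calt_mulDr.

Fact calt_scaleAl (a : F) (p q : C) : a *: (p ** q) = (a *: p) ** q.
Proof.
elim/to_caltP: p => x; elim/to_caltP: q => y.
rewrite /GRing.scale /namul /= !caltE.
by apply/to_calt_eqP; exact: crel_scaleAl.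
Qed.
Fact calt_scaleAr (a : F) (p q : C) : a *: (p ** q) = p ** (a *: q).
Proof.
elim/to_caltP: p => x; elim/to_caltP: q => y.
rewrite /GRing.scale /namul /= !caltE.
by apply/to_calt_eqP; exact: crel_scaleAr.
Qed.

HB.instance Definition _ :=
  NARing_isNAAlgebra.Build F C calt_scaleAl calt_scaleAr.

Lemma altClifford_alternative : na_alternative C.
Proof.
elim/to_caltP=> x; elim/to_caltP=> y; rewrite /associator /namul /= !caltE.
by split; apply/eqP; rewrite subr_eq0; apply/eqP/to_calt_eqP;
  [exact: crel_altl | exact: crel_altr].
Qed.

Lemma calt_gen_linear : linear calt_gen.
Proof.
move=> a v w; rewrite /calt_gen /GRing.add /GRing.scale /= !caltE.
apply/to_calt_eqP; apply: crel_trans (crel_genD _ _) _.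
by apply: crel_congAdd (crel_genZ _ _) (crel_refl _).
Qed.

Lemma calt_gen_sq v : calt_gen v ** calt_gen v = phi v *: naone :> C.
Proof.
rewrite /calt_gen /GRing.scale /namul /naone /= /calt_one !caltE.
by apply/to_calt_eqP; exact: crel_sq.
Qed.

Lemma altClifford_universal (A : naAlgType F) (f : {linear V -> A}) :
  na_alternative A -> (forall v, f v ** f v = phi v *: naone) ->
  exists! g : C -> A,
    [/\ na_morphism g, scalable g & forall v, g (calt_gen v) = f v].
Proof.
move=> altA sqf.
pose ev := fix ev (x : cterm) : A := match x with
  | CGen v => f v | CZero => 0 | COne => naone
  | CAdd x y => ev x + ev y | COpp x => - ev x
  | CMul x y => ev x ** ev y | CScale a x => a *: ev x end.
have evP x y : crel x y -> ev x = ev y.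
  elim=> //=; do ?[by move=> *; congruence].
  - by move=> *; rewrite addrA.
  - by move=> *; rewrite addrC.
  - by move=> *; rewrite add0r.
  - by move=> *; rewrite addNr.
  - by move=> *; rewrite scalerA.
  - by move=> *; rewrite scale1r.
  - by move=> *; exact: scalerDr.
  - by move=> *; exact: scalerDl.
  - by move=> *; exact: namul1r.
  - by move=> *; exact: namulr1.
  - by move=> *; exact: namulDl.
  - by move=> *; exact: namulDr.
  - by move=> *; exact: nascalerAl.
  - by move=> *; exact: nascalerAr.
  - by move=> *; apply/eqP; rewrite -subr_eq0; apply/eqP; apply: (altA _ _).1.
  - by move=> *; apply/eqP; rewrite -subr_eq0; apply/eqP; apply: (altA _ _).2.
  - by move=> *; rewrite linearD.
  - by move=> *; rewrite linearZ.
pose g (p : C) : A := ev (of_calt p).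
have gE x : g (to_calt x) = ev x by apply/evP/of_calt_rel.
exists g; split.
  split=> [|a|v]; last exact: gE.
    split=> [||]; last exact: gE.
    + elim/to_caltP=> x; elim/to_caltP=> y.
      by rewrite [X in g X]calt_addE !gE.
    + elim/to_caltP=> x; elim/to_caltP=> y.
      by rewrite [X in g X]calt_mulE !gE.
  by elim/to_caltP=> x; rewrite [X in g X]calt_scaleE !gE.
move=> g' [[gD gM g1] gZ gG]; apply/funext; elim/to_caltP=> x; rewrite gE.
have g0 : g' 0 = 0 by apply: (addrI (g' 0)); rewrite -gD !addr0.
elim: x => /= [v||| x IHx y IHy| x IHx| x IHx y IHy| a x IHx] //.
- by rewrite -gG.
- by rewrite IHx IHy -gD -calt_addE.
- by apply: (addrI (ev x)); rewrite subrr IHx -gD -g0 -calt_oppE addrN.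
- by rewrite IHx IHy -gM -calt_mulE.
- by rewrite IHx -gZ -calt_scaleE.
Qed.

End AltClifford.

Section CayleyDickson.
Variables (K : fieldType) (Q : falgType K).

Definition is_quaternion : Prop :=
  [/\ 'Z({:Q})%VS = 1%VS,
      forall I : {vspace Q}, ({:Q} * I <= I)%VS -> (I * {:Q} <= I)%VS ->
        I = 0%VS \/ I = {:Q}%VS &
      \dim {:Q} = 4%N].

(* On a quaternion algebra these conditions determine the conjugation, in every
   characteristic. *)
Record conjugation := Conjugation {
  conj_fun :> {linear Q -> Q};
  conjM : forall x y, conj_fun (x * y) = conj_fun y * conj_fun x;
  conjK : involutive conj_fun;
  conj_trace : forall x, x + conj_fun x \in 1%VS;
  conj_norm : forall x, x * conj_fun x \in 1%VS
}.

Lemma conj1 (c : conjugation) : c 1 = 1.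
Proof. by rewrite -[LHS]mulr1 -{2}[1](conjK c) -conjM mulr1 conjK. Qed.

(* (a, b) stands for a + b z, where z^2 = gamma and z a = (c a) z. *)
Definition cayley_dickson (c : conjugation) (gamma : K) : Type := (Q * Q)%type.

Variables (c : conjugation) (gamma : K).
Local Notation D := (cayley_dickson c gamma).

HB.instance Definition _ := GRing.Zmodule.on D.

Definition cd_one : D := (1, 0).
Definition cd_mul (x y : D) : D :=
  (x.1 * y.1 + gamma *: (c y.2 * x.2), y.2 * x.1 + x.2 * c y.1).

Fact cd_mul1r : left_id cd_one cd_mul.
Proof.
by case=> a b; rewrite /cd_mul /= mul1r mulr0 scaler0 addr0 mulr1 mul0r addr0.
Qed.
Fact cd_mulr1 : right_id cd_one cd_mul.
Proof.
case=> a b; rewrite /cd_mul /= linear0 mul0r scaler0 addr0 mulr1 mul0r add0r.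
by rewrite conj1 mulr1.
Qed.
Fact cd_mulDl : left_distributive cd_mul +%R.
Proof.
move=> [a b] [a' b'] [d e]; rewrite /cd_mul; congr (_, _) => /=.
  by rewrite mulrDl mulrDr scalerDr addrACA.
by rewrite mulrDl mulrDr addrACA.
Qed.
Fact cd_mulDr : right_distributive cd_mul +%R.
Proof.
move=> [a b] [a' b'] [d e]; rewrite /cd_mul; congr (_, _) => /=.
  by rewrite linearD mulrDl mulrDr scalerDr addrACA.
by rewrite linearD mulrDl mulrDr addrACA.
Qed.

HB.instance Definition _ := Zmodule_isNARing.Build D
  cd_mul1r cd_mulr1 cd_mulDl cd_mulDr.

End CayleyDickson.

(* K becomes the center of A, so a ring isomorphism suffices. *)
Definition is_octonion (A : naRingType) : Prop :=
  exists (K : fieldType) (Q : falgType K) (c : conjugation Q) (gamma : K)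
         (f : cayley_dickson c gamma -> A),
    [/\ is_quaternion Q, gamma != 0, na_morphism f & bijective f].

(* Main.v *)
Require Import Defs.
From HB Require Import structures.
From mathcomp Require Import all_boot all_order all_algebra all_field.
From mathcomp Require Import boolp zify ring.
Set Implicit Arguments.
Unset Strict Implicit.
Unset Printing Implicit Defensive.
Import GRing.Theory.
Local Open Scope ring_scope.

(** Choose a basis x, y, z of V with x y + y x = 1 in the Clifford algebra C
    and z orthogonal to x and y, and put a = phi x, b = phi y, c = phi z.
    Nondegeneracy means that d = 1 - 4ab and c are nonzero ([ternary_basis]).
    Then x and y generate a copy of the quaternion algebra Q with basis
    1, x, y, u = x y.

    In an octonion algebra containing Q, the element z would decompose as
    w + s (2u - 1), where w is orthogonal to Q and 2u - 1 = x y - y x spans the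
    line of Q orthogonal to 1, x and y. Here s = t / d, where
    t = u z + z u - z is the trace of z u. The heart of the proof is that t is
    central in C ([clifford_t_central]). Kleinfeld's function of four
    variables is alternating, and this lets an induction on the length of words
    reduce centrality to the generators ([central_of_generators]). On
    generators centrality follows from the fact that g = (x, y, z)
    anticommutes with x, y and z, and satisfies g u + u g = g.

    The would-be square of w, gamma = c - t^2 / d, is therefore central as
    well. It is not nilpotent: the octonion algebra (Q, c) is a quotient of C in
    which t becomes 0 and gamma becomes c ([gamma_pow_neq0]). So the powers of
    gamma may be inverted.

    Let A be a simple quotient of the localization. Its center K is a field, and
    over K the element w = z - (t / d) (2u - 1) makes sense and satisfies
    w q = (conj q) w for q in Q and w^2 = gamma, which is invertible. The
    alternative laws then force the products in Q + Q w to be those of the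
    Cayley-Dickson double ([doubling_map_morphism]). The resulting map from the
    double of Q over K to A is injective because the commutator x y - y x is
    invertible ([doubling_map_inj]), and surjective because its image is a
    subring which contains K and the images of x, y and z. *)

(** * Linear identities in abelian groups and modules *)

(** The module M becomes a square-zero ideal of this commutative ring, so that
    [ring] can decide linear identities of M after the injection
    [in_trivext]. *)
Definition trivext (K : comNzRingType) (M : lmodType K) : Type := (K * M)%type.

Section TrivialExtension.
Variables (K : comNzRingType) (M : lmodType K).
Local Notation T := (trivext M).

HB.instance Definition _ := GRing.Zmodule.on T.

Definition trivext_one : T := (1, 0).
Definition trivext_mul (p q : T) : T := (p.1 * q.1, q.1 *: p.2 + p.1 *: q.2).

Fact trivext_mulA : associative trivext_mul.
Proof.
move=> [i x] [j y] [k z]; rewrite /trivext_mul /= mulrA; congr (_, _).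
rewrite !scalerDr !scalerA addrA.
by congr (_ *: _ + _ *: _ + _ *: _); ring.
Qed.
Fact trivext_mulC : commutative trivext_mul.
Proof. by move=> p q; rewrite /trivext_mul mulrC addrC. Qed.
Fact trivext_mul1 : left_id trivext_one trivext_mul.
Proof. by case=> i x; rewrite /trivext_mul /= mul1r scaler0 add0r scale1r. Qed.
Fact trivext_mulD : left_distributive trivext_mul +%R.
Proof.
move=> [i x] [j y] [k z]; rewrite /trivext_mul /= mulrDl; congr (_, _).
by rewrite scalerDl scalerDr addrACA.
Qed.
Fact trivext_one_neq0 : trivext_one != 0.
Proof. by apply/eqP => -[/eqP]; rewrite oner_eq0. Qed.

HB.instance Definition _ := GRing.Zmodule_isComNzRing.Build T
  trivext_mulA trivext_mulC trivext_mul1 trivext_mulD trivext_one_neq0.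

Definition trivext_scalar (k : K) : T := (k, 0).
Fact trivext_scalar_additive : zmod_morphism trivext_scalar.
Proof. by move=> k l; congr (_, _); rewrite subrr. Qed.
Fact trivext_scalar_monoid : monoid_morphism trivext_scalar.
Proof. by split=> // k l; congr (_, _); rewrite !scaler0 addr0. Qed.
HB.instance Definition _ :=
  GRing.isZmodMorphism.Build K T trivext_scalar trivext_scalar_additive.
HB.instance Definition _ :=
  GRing.isMonoidMorphism.Build K T trivext_scalar trivext_scalar_monoid.

Definition in_trivext (x : M) : T := (0, x).
Fact in_trivext_additive : zmod_morphism in_trivext.
Proof. by move=> x y; congr (_, _); rewrite subrr. Qed.
HB.instance Definition _ :=
  GRing.isZmodMorphism.Build M T in_trivext in_trivext_additive.

Lemma in_trivextZ k x : in_trivext (k *: x) = trivext_scalar k * in_trivext x.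
Proof. by congr (_, _); rewrite /= ?mulr0 // scale0r add0r. Qed.

Lemma in_trivextD x y : in_trivext (x + y) = in_trivext x + in_trivext y.
Proof. exact: raddfD. Qed.
Lemma in_trivextN x : in_trivext (- x) = - in_trivext x.
Proof. exact: raddfN. Qed.
Lemma in_trivext0 : in_trivext 0 = 0. Proof. by []. Qed.

Lemma in_trivext_inj x y : in_trivext x = in_trivext y -> x = y.
Proof. by case. Qed.

End TrivialExtension.

Definition zmod_trivext (M : zmodType) (x : M) : trivext (zmodule M) :=
  in_trivext (x : zmodule M).
HB.instance Definition _ (M : zmodType) :=
  GRing.isZmodMorphism.Build M (trivext (zmodule M)) (@zmod_trivext M)
    (@in_trivext_additive _ (zmodule M)).

Lemma zmod_trivext_inj (M : zmodType) : injective (@zmod_trivext M).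
Proof. by move=> x y []. Qed.

Lemma eq_of_sub_eq (M : zmodType) (x y x' y' : M) :
  x' = y' -> x - y = x' - y' -> x = y.
Proof. by move=> ->; rewrite subrr => /eqP; rewrite subr_eq0 => /eqP. Qed.

(** [zmod h] proves an equation whose two sides differ by the same element as
    those of [h], up to sign. *)
Tactic Notation "zmod" := apply: zmod_trivext_inj; ring.
Tactic Notation "zmod" uconstr(H) :=
  first [refine (eq_of_sub_eq H _); zmod | refine (eq_of_sub_eq (esym H) _); zmod].

Tactic Notation "lmod" :=
  apply: in_trivext_inj;
  rewrite ?(in_trivextD, in_trivextN, in_trivext0, in_trivextZ); ring.

(** * Alternative rings *)

Section Alternative.
Variable R : naRingType.
Implicit Types a b c d p q r t x y z : R.

Definition na_expand :=
  (@namulDl R, @namulDr R, @namulNr R, @namulrN R, @namul0r R, @namulr0 R,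
   @namul1r R, @namulr1 R).

(** Rules that push signs and zeros only: unlike the distributive laws, their
    patterns do not match the difference hidden in [associator]. *)
Definition na_sign := (@namulNr R, @namulrN R, @namul0r R, @namulr0 R).

Lemma associator_eq0 a b c :
  associator a b c = 0 <-> (a ** b) ** c = a ** (b ** c).
Proof.
by rewrite /associator; split=> [/eqP|->]; rewrite ?subr_eq0 ?subrr // => /eqP.
Qed.

Lemma associatorDl a a' b c :
  associator (a + a') b c = associator a b c + associator a' b c.
Proof. by rewrite /associator !na_expand; zmod. Qed.
Lemma associatorDm a b b' c :
  associator a (b + b') c = associator a b c + associator a b' c.
Proof. by rewrite /associator !na_expand; zmod. Qed.
Lemma associatorDr a b c c' :
  associator a b (c + c') = associator a b c + associator a b c'.
Proof. by rewrite /associator !na_expand; zmod. Qed.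

Lemma associator0l b c : associator 0 b c = 0.
Proof. by rewrite /associator !na_expand subrr. Qed.
Lemma associatorNl a b c : associator (- a) b c = - associator a b c.
Proof. by rewrite /associator !na_expand; zmod. Qed.
Lemma associatorNm a b c : associator a (- b) c = - associator a b c.
Proof. by rewrite /associator !na_expand; zmod. Qed.
Lemma associatorNr a b c : associator a b (- c) = - associator a b c.
Proof. by rewrite /associator !na_expand; zmod. Qed.

(** The Teichmuller identity, valid in every nonassociative ring. *)
Lemma teichmuller a b c d :
  associator (a ** b) c d - associator a (b ** c) d + associator a b (c ** d) =
  a ** associator b c d + associator a b c ** d.
Proof. by rewrite /associator !na_expand; zmod. Qed.

Hypothesis altR : na_alternative R.

Lemma associator_aab a b : associator a a b = 0. Proof. exact: (altR a b).1. Qed.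
Lemma associator_abb a b : associator a b b = 0. Proof. exact: (altR a b).2. Qed.

Lemma associatorCl a b c : associator b a c = - associator a b c.
Proof.
have := associator_aab (a + b) c.
rewrite associatorDl !associatorDm !associator_aab => h; zmod h.
Qed.
Lemma associatorCr a b c : associator a c b = - associator a b c.
Proof.
have := associator_abb a (b + c).
rewrite associatorDm !associatorDr !associator_abb => h; zmod h.
Qed.
Lemma associator_rot a b c : associator b c a = associator a b c.
Proof. by rewrite associatorCr associatorCl opprK. Qed.
Lemma associator_aba a b : associator a b a = 0.
Proof. by rewrite associatorCr associator_aab oppr0. Qed.

Lemma flexible a b : (a ** b) ** a = a ** (b ** a).
Proof. exact/associator_eq0/associator_aba. Qed.
Lemma alt_mull a b : a ** (a ** b) = (a ** a) ** b.
Proof. exact/esym/associator_eq0/associator_aab. Qed.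
Lemma alt_mulr a b : (a ** b) ** b = a ** (b ** b).
Proof. exact/associator_eq0/associator_abb. Qed.
Lemma alt_mull_lin a b c : a ** (b ** c) + b ** (a ** c) = (a ** b + b ** a) ** c.
Proof.
have h := associatorCl a b c; rewrite /associator in h.
by rewrite na_expand; zmod h.
Qed.
Lemma alt_mulr_lin a b c : (a ** b) ** c + (a ** c) ** b = a ** (b ** c + c ** b).
Proof.
have h := associatorCr a b c; rewrite /associator in h.
by rewrite na_expand; zmod h.
Qed.

(** Kleinfeld's function measures how far D = (-, c, d) is from satisfying
    D(ab) = b D(a) + D(b) a. In an alternative ring it is alternating in its
    four arguments. *)
Definition kleinfeld a b c d :=
  associator (a ** b) c d - b ** associator a c d - associator b c d ** a.

(** The cyclic invariance up to sign, visible in this form, turns the trivial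
    vanishing at c = d into vanishing at any two adjacent equal arguments. *)
Lemma kleinfeld_cycle a b c d : kleinfeld a b c d =
  associator (a ** b) c d - associator (b ** c) d a +
  associator (c ** d) a b - associator (d ** a) b c.
Proof.
have h := teichmuller b c d a.
rewrite -[associator b (c ** d) a]associator_rot in h.
rewrite [associator b c (d ** a)]associator_rot in h.
rewrite [associator c d a]associator_rot in h.
rewrite /kleinfeld; zmod h.
Qed.

Lemma kleinfeld_shift a b c d : kleinfeld b c d a = - kleinfeld a b c d.
Proof. by rewrite !kleinfeld_cycle; zmod. Qed.

Lemma kleinfeld_abcc a b c : kleinfeld a b c c = 0.
Proof. by rewrite /kleinfeld !associator_abb !na_sign; zmod. Qed.
Lemma kleinfeld_abba a b c : kleinfeld a b b c = 0.
Proof. by rewrite kleinfeld_shift kleinfeld_abcc oppr0. Qed.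
Lemma kleinfeld_aabc a b c : kleinfeld a a b c = 0.
Proof. by rewrite kleinfeld_shift kleinfeld_abba oppr0. Qed.

Lemma kleinfeldDl a a' b c d :
  kleinfeld (a + a') b c d = kleinfeld a b c d + kleinfeld a' b c d.
Proof. by rewrite /kleinfeld !(na_expand, associatorDl); zmod. Qed.
Lemma kleinfeldDml a b b' c d :
  kleinfeld a (b + b') c d = kleinfeld a b c d + kleinfeld a b' c d.
Proof. by rewrite /kleinfeld !(associatorDl, na_expand); zmod. Qed.
Lemma kleinfeldDmr a b c c' d :
  kleinfeld a b (c + c') d = kleinfeld a b c d + kleinfeld a b c' d.
Proof. by rewrite /kleinfeld !(associatorDm, associatorDr, na_expand); zmod. Qed.

Lemma kleinfeldCl a b c d : kleinfeld b a c d = - kleinfeld a b c d.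
Proof.
have h := kleinfeld_aabc (a + b) c d.
rewrite kleinfeldDl !kleinfeldDml !kleinfeld_aabc in h; zmod h.
Qed.
Lemma kleinfeldCm a b c d : kleinfeld a c b d = - kleinfeld a b c d.
Proof.
have h := kleinfeld_abba a (b + c) d.
rewrite kleinfeldDml !kleinfeldDmr !kleinfeld_abba in h; zmod h.
Qed.

(** Writing each associator that contains a product as a value of Kleinfeld's
    function f plus two correction terms turns both this right-hand side and
    that of [kleinfeld_cycle] into 4 f plus the same sum of commutators. So no
    division is needed, and the formula holds in every characteristic. *)
Lemma kleinfeld_commutator a b c d : kleinfeld a b c d =
  associator (a ** b - b ** a) c d + associator (c ** d - d ** c) a b.
Proof.
have E x y z t : associator (x ** y) z t =
    kleinfeld x y z t + y ** associator x z t + associator y z t ** x.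
  by rewrite /kleinfeld; zmod.
have k := kleinfeld_cycle a b c d; rewrite !E in k.
have k1 : kleinfeld b c d a = - kleinfeld a b c d by exact: kleinfeld_shift.
have k2 : kleinfeld c d a b = kleinfeld a b c d.
  by rewrite kleinfeld_shift k1 opprK.
have k3 : kleinfeld d a b c = - kleinfeld a b c d.
  by rewrite kleinfeld_shift k2.
have k4 : kleinfeld d c a b = - kleinfeld a b c d by rewrite kleinfeldCl k2.
rewrite !associatorDl.
rewrite !associatorNl !E (kleinfeldCl a b) k2 k4.
rewrite k1 k2 k3 in k.
rewrite -[associator c a b]associator_rot -[associator d a b]associator_rot.
rewrite -[associator c a b]associator_rot -[associator d a b]associator_rot in k.
rewrite [associator b d a]associator_rot [associator c d a]associator_rot in k.
rewrite -[associator d b c]associator_rot in k.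
by zmod k.
Qed.

Lemma associator_pqp p q r : associator p (q ** p) r = p ** associator p q r.
Proof.
have h := kleinfeld_abba q p r; rewrite /kleinfeld associator_aab !na_sign in h.
rewrite associatorCl [associator p q r]associatorCl na_sign; zmod h.
Qed.
Lemma associator_ppq p q r : associator p (p ** q) r = associator p q r ** p.
Proof.
have h : kleinfeld p q p r = 0 by rewrite kleinfeldCm kleinfeld_aabc oppr0.
rewrite /kleinfeld associator_aab !na_sign in h.
rewrite associatorCl [associator p q r]associatorCl na_sign; zmod h.
Qed.

Lemma associator_ppq_lin p p' q r :
  associator p (p' ** q) r + associator p' (p ** q) r =
  associator p q r ** p' + associator p' q r ** p.
Proof.
have h := associator_ppq (p + p') q r.
rewrite namulDl !associatorDl !associatorDm namulDr in h.
rewrite !(namulDl (associator _ _ _)) !associator_ppq in h.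
zmod h.
Qed.

Lemma moufang_middle x a b : (x ** a) ** (b ** x) = x ** ((a ** b) ** x).
Proof.
have h1 := associator_pqp x b a.
rewrite associatorCr [associator x b a]associatorCr na_sign in h1.
rewrite -[associator x a b]associator_rot in h1.
rewrite /associator !na_expand in h1; zmod h1.
Qed.
End Alternative.

(** * Associators of anticommuting elements *)

Section OrthogonalAssociators.
Variable R : naRingType.
Hypothesis altR : na_alternative R.
Implicit Types p q r g x y z u : R.

(** The left-hand side is the associator (p, pq + qp, r). *)
Lemma associator_anticomm p q r : na_central (p ** q + q ** p) ->
  associator p q r ** p + p ** associator p q r = 0.
Proof.
case=> _ h _ _.
by rewrite -(associator_ppq altR) -(associator_pqp altR) -associatorDm h.
Qed.

(** With g = (p, q, r), this reads g u + u g = g for u = p q when p q + q p = 1,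
    and says that g and p q anticommute when p and q do. *)
Lemma associator_anticomm_prod p q r :
    na_central (q ** q) -> na_central (p ** q + q ** p) ->
  associator p q r ** (p ** q) + (p ** q) ** associator p q r =
  (p ** q + q ** p) ** associator p q r.
Proof.
move=> sq jpq; set g := associator p q r.
have h := associator_ppq_lin altR p (p ** q) q r.
have [_ sq0 _ _] := sq.
rewrite (associator_aab altR) (alt_mulr altR) (associator_ppq altR) sq0 in h.
rewrite (associatorCl altR q (p ** q)) (associator_pqp altR) in h.
rewrite (associatorCl altR p q) in h.
rewrite -/g !na_sign opprK addr0 in h.
have k := alt_mulr_lin altR q g p.
rewrite (associator_anticomm r jpq) namulr0 in k.
rewrite (namulDl (p ** q)); zmod (etrans (esym h) (esym k)).
Qed.

(** Both products reduce to the products of g and x z, which anticommute: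
    (g x) z = (x z) g and z (g x) = g (x z). *)
Lemma anticomm_prod g x z :
    g ** x + x ** g = 0 -> g ** z + z ** g = 0 -> x ** z + z ** x = 0 ->
    g ** (x ** z) + (x ** z) ** g = 0 ->
  (g ** x) ** z + z ** (g ** x) = 0.
Proof.
move=> gx gz xz gxz.
have h1 := alt_mull_lin altR z g x; rewrite [z ** g + _]addrC gz in h1.
have h2 := alt_mulr_lin altR g x z; rewrite xz in h2.
have h3 := alt_mulr_lin altR z g x; rewrite gx in h3.
have h4 : (g ** z) ** x + (z ** g) ** x = 0 by rewrite -namulDl gz namul0r.
have h5 : g ** (x ** z) + g ** (z ** x) = 0 by rewrite -namulDr xz namulr0.
have h6 : (x ** z) ** g + (z ** x) ** g = 0 by rewrite -namulDl xz namul0r.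
rewrite namul0r in h1; rewrite !namulr0 in h2 h3.
have e1 : (g ** x) ** z = (z ** g) ** x by zmod (etrans h2 (esym h4)).
have e2 : (z ** g) ** x = (x ** z) ** g by zmod (etrans h3 (esym h6)).
have e3 : z ** (g ** x) = g ** (x ** z) by zmod (etrans h1 (esym h5)).
by rewrite e1 e2 e3 addrC.
Qed.
End OrthogonalAssociators.

(** In this section x, y, z satisfy the relations of an adapted basis of V, and t
    is the element of the ring that represents the trace of z (x y). *)
Section CentralElement.
Variable R : naRingType.
Hypothesis altR : na_alternative R.

Lemma na_central1 : na_central (naone : R).
Proof.
by split=> *; rewrite ?associator_eq0 ?namul1r ?namulr1.
Qed.
Lemma na_central0 : na_central (0 : R).
Proof.
by split=> *; rewrite ?associator_eq0 ?namul0r ?namulr0 ?namul0r.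
Qed.

Variables x y z : R.
Hypotheses (sqx : na_central (x ** x)) (sqy : na_central (y ** y)).
Hypothesis sqz : na_central (z ** z).
Hypothesis jxy : x ** y + y ** x = naone.
Hypotheses (jxz : x ** z + z ** x = 0) (jyz : y ** z + z ** y = 0).

Let u := x ** y.
Let t := u ** z + z ** u - z.

Let jux : u ** x + x ** u = x.
Proof.
by rewrite /u flexible // -namulDr addrC jxy namulr1.
Qed.
Let juy : u ** y + y ** u = y.
Proof.
by rewrite /u -flexible // -namulDl jxy namul1r.
Qed.

(** The commutator of t with v vanishes by linearized alternativity alone, given
    that v anticommutes with z and that u v + v u = v, as x and y do. *)
Let t_comm v : u ** v + v ** u = v -> v ** z + z ** v = 0 -> t ** v = v ** t.
Proof.
move=> juv jvz; rewrite /t !na_expand.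
have h1 := alt_mull_lin altR v u z; rewrite [v ** u + _]addrC juv in h1.
have h2 := alt_mulr_lin altR z u v; rewrite juv in h2.
have h3 := associatorCr altR v u z; have h4 := associator_rot altR v u z.
rewrite /associator in h3 h4.
have e1 : z ** v = - (v ** z) by zmod jvz.
rewrite e1 !na_sign in h1 h2 h4 *.
have e2 : (z ** u) ** v = (v ** z) ** u - v ** z by zmod h2.
have e3 : (u ** z) ** v = (v ** u) ** z - v ** (u ** z) - u ** (v ** z).
  by zmod h4.
have e4 : v ** (z ** u) = (v ** z) ** u + (v ** u) ** z - v ** (u ** z).
  by zmod h3.
rewrite e2 e3 e4; zmod h1.
Qed.

Let tx : t ** x = x ** t. Proof. exact: t_comm. Qed.
Let ty : t ** y = y ** t. Proof. exact: t_comm. Qed.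
Let tz : t ** z = z ** t.
Proof.
case: sqz => _ _ _ zC; rewrite /t !na_expand (alt_mulr altR) (alt_mull altR) zC.
by rewrite (flexible altR); zmod.
Qed.

Let g := associator x y z.

Let c1 : na_central (x ** y + y ** x).
Proof. by rewrite jxy; exact: na_central1. Qed.
Let c2 : na_central (x ** z + z ** x).
Proof. by rewrite jxz; exact: na_central0. Qed.
Let c3 : na_central (y ** z + z ** y).
Proof. by rewrite jyz; exact: na_central0. Qed.

Let gx : g ** x + x ** g = 0. Proof. exact: associator_anticomm. Qed.
Let gy : g ** y + y ** g = 0.
Proof. by rewrite /g -associator_rot //; apply: associator_anticomm. Qed.
Let gz : g ** z + z ** g = 0.
Proof.
by rewrite /g associator_rot //; apply: associator_anticomm => //; rewrite addrC.
Qed.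
Let gu : g ** u + u ** g = g.
Proof. by rewrite associator_anticomm_prod // jxy namul1r. Qed.
Let gxz : g ** (x ** z) + (x ** z) ** g = 0.
Proof.
have := associator_anticomm_prod altR y sqz c2.
rewrite (associatorCr altR x y) -/g jxz !na_sign => h; zmod h.
Qed.
Let gyz : g ** (y ** z) + (y ** z) ** g = 0.
Proof.
have := associator_anticomm_prod altR x sqz c3.
by rewrite (associator_rot altR) -/g jyz !na_sign.
Qed.

(** Adding the values of Kleinfeld's function at (u, z, x, y) and (z, u, x, y)
    leaves (t, x, y) = g u + u g - g. *)
Let txy : associator t x y = 0.
Proof.
have h := kleinfeldCl altR u z x y; rewrite /kleinfeld in h.
have uxy : associator u x y = 0.
  by rewrite associatorCl // associator_ppq // associator_abb // na_sign oppr0.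
rewrite uxy -(associator_rot altR z x y) -/g !na_sign in h.
rewrite /t !associatorDl associatorNl -(associator_rot altR z x y) -/g.
have e : associator (u ** z) x y + associator (z ** u) x y = g ** u + u ** g.
  by zmod h.
by rewrite e gu subrr.
Qed.

(** For the pairs (x, z) and (y, z) the associator with t becomes an
    anticommutator with z of (z, u, v), which is -g x or -g y. *)
Let tvz v : associator v z t = associator z u v ** z + z ** associator z u v.
Proof.
rewrite -associator_rot // /t !(associatorDm, associatorNm).
by rewrite associator_aab // associator_pqp // associator_ppq // oppr0 addr0 addrC.
Qed.

Let txz : associator t x z = 0.
Proof.
rewrite -associator_rot // tvz -associator_rot // associatorCl // associator_ppq //.
have h := anticomm_prod altR gx gz jxz gxz.
by rewrite -/g !na_sign -opprD h oppr0.
Qed.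
Let tyz : associator t y z = 0.
Proof.
have h := anticomm_prod altR gy gz jyz gyz.
have e : associator z u y = - (g ** y).
  rewrite associatorCl // associatorCr // associatorCl // associator_pqp //.
  by rewrite (associatorCl altR x y) -/g !na_sign !opprK; zmod gy.
by rewrite -associator_rot // tvz e !na_sign -opprD h oppr0.
Qed.

Let gens : R -> Prop := fun v => [\/ v = x, v = y | v = z].

Lemma clifford_gens_commute v : gens v -> t ** v = v ** t.
Proof. by case=> ->. Qed.

Lemma clifford_gens_associate v w : gens v -> gens w -> associator t v w = 0.
Proof.
have C a b : associator t a b = 0 -> associator t b a = 0.
  by move=> h; rewrite associatorCr // h oppr0.
by case=> -> [] ->; rewrite ?associator_abb //; apply: C.
Qed.
End CentralElement.

(** * A centrality criterion *)

Section CentralityCriterion.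
Variables (F : fieldType) (R : naAlgType F) (G : R -> Prop).
Hypothesis altR : na_alternative R.

Inductive word : nat -> R -> Prop :=
| word_gen v : G v -> word 1 v
| word_mul m n p q : word m p -> word n q -> word (m + n) (p ** q).

Lemma word_gt0 n p : word n p -> (0 < n)%N.
Proof. by elim=> // m k *; rewrite addn_gt0; apply/orP; left. Qed.

Variable t : R.
Hypothesis t_comm : forall v, G v -> t ** v = v ** t.
Hypothesis t_assoc : forall v w, G v -> G w -> associator t v w = 0.

(** Associators are treated first. If (t, p, r) = (t, q, r) = 0 and t commutes
    with r, both expressions of Kleinfeld's function at (q, p, t, r) give
    (qp, t, r) = (qp, t, r) - (pq, t, r), hence (t, pq, r) = 0. All hypotheses
    used concern words of smaller total length, because every word has positive
    length. *)
Lemma word_central n :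
  (forall i p, word i p -> (i <= n)%N -> t ** p = p ** t) /\
  (forall i j p q, word i p -> word j q -> (i + j <= n)%N ->
     associator t p q = 0).
Proof.
elim/ltn_ind: n => n IH.
have prod_assoc i j k p q r : word i p -> word j q -> word k r ->
    (i + j + k <= n)%N -> associator t (p ** q) r = 0.
  move=> wp wq wr le_n.
  have [[i0 j0] k0] := (word_gt0 wp, word_gt0 wq, word_gt0 wr).
  have lt_n : (n.-1 < n)%N by lia.
  have [IHc IHa] := IH n.-1 lt_n.
  have tp : associator t p r = 0 by apply: (IHa i k) => //; lia.
  have tq : associator t q r = 0 by apply: (IHa j k) => //; lia.
  have tr : t ** r = r ** t by apply: (IHc k) => //; lia.
  have h := kleinfeld_commutator altR q p t r.
  rewrite /kleinfeld tr subrr (associatorCl altR t q) (associatorCl altR t p) in h.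
  rewrite tp tq !oppr0 !na_sign in h.
  rewrite associatorDl associatorNl in h.
  have z : associator 0 q p = 0 by apply: associator0l.
  by rewrite associatorCl //; rewrite z in h; zmod h.
have A i j p q : word i p -> word j q -> (i + j <= n)%N -> associator t p q = 0.
  case=> [v Gv|i1 i2 p1 p2 wp1 wp2]; last exact: prod_assoc.
  case=> [w Gw _|j1 j2 q1 q2 wq1 wq2 le_n]; first exact: t_assoc.
  rewrite associatorCr // (prod_assoc j1 j2 1%N) ?oppr0 //; first exact: word_gen.
  by lia.
split=> // i p; case=> [v /t_comm//|j k a b wa wb] le_n.
have [j0 k0] := (word_gt0 wa, word_gt0 wb).
have lt_n : (n.-1 < n)%N by lia.
have [IHc _] := IH n.-1 lt_n.
have tab := A _ _ _ _ wa wb le_n.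
have ta : t ** a = a ** t by apply: (IHc j) => //; lia.
have tb : t ** b = b ** t by apply: (IHc k) => //; lia.
have /associator_eq0 e1 := tab; rewrite -e1 ta.
have /associator_eq0 -> : associator a t b = 0 by rewrite associatorCl // tab oppr0.
have /associator_eq0 -> : associator a b t = 0 by rewrite associator_rot.
by rewrite tb.
Qed.

Definition na_generates := forall P : R -> Prop,
  P naone -> (forall p q, P p -> P q -> P (p + q)) ->
  (forall a p, P p -> P (a *: p)) -> (forall p q, P p -> P q -> P (p ** q)) ->
  (forall v, G v -> P v) -> forall p, P p.

Inductive word_span : R -> Prop :=
| span1 : word_span naone
| span_word n p : word n p -> word_span p
| span_add p q : word_span p -> word_span q -> word_span (p + q)
| span_scale a p : word_span p -> word_span (a *: p).

Lemma word_spanM p q : word_span p -> word_span q -> word_span (p ** q).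
Proof.
elim=> [|n {}p wp|p1 p2 _ h1 _ h2|a {}p _ h] sq.
- by rewrite namul1r.
- elim: sq => [|m {}q wq|q1 q2 _ h1 _ h2|a {}q _ h].
  + by rewrite namulr1; apply: span_word wp.
  + by apply: span_word (word_mul wp wq).
  + by rewrite namulDr; apply: span_add.
  + by rewrite -nascalerAr; apply: span_scale.
- by rewrite namulDl; apply: span_add; auto.
- by rewrite -nascalerAl; apply: span_scale; auto.
Qed.

Lemma associatorZm (a : F) (p q r : R) :
  associator p (a *: q) r = a *: associator p q r.
Proof. by rewrite /associator scalerBr; do !rewrite -?nascalerAl -?nascalerAr. Qed.
Lemma associatorZr (a : F) (p q r : R) :
  associator p q (a *: r) = a *: associator p q r.
Proof. by rewrite /associator scalerBr; do !rewrite -?nascalerAl -?nascalerAr. Qed.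

Theorem central_of_generators : na_generates -> na_central t.
Proof.
move=> gen.
have S p : word_span p.
  apply: (gen word_span); [exact: span1|exact: span_add|exact: span_scale| |].
    exact: word_spanM.
  by move=> v Gv; apply: span_word (word_gen Gv).
have one_c := na_central1 R.
have C p : t ** p = p ** t.
  elim: (S p) => [|n {}p wp|p1 p2 _ h1 _ h2|a {}p _ h].
  - by rewrite namul1r namulr1.
  - exact: (word_central n).1 wp (leqnn n).
  - by rewrite namulDl namulDr h1 h2.
  - by rewrite -nascalerAl -nascalerAr h.
have A p q : associator t p q = 0.
  elim: (S p) => [|n {}p wp|p1 p2 _ h1 _ h2|a {}p _ h].
  - by case: one_c.
  - elim: (S q) => [|m {}q wq|q1 q2 _ h1 _ h2|a {}q _ h].
    + by case: one_c.
    + exact: (word_central (n + m)).2 wp wq (leqnn _).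
    + by rewrite associatorDr h1 h2 addr0.
    + by rewrite associatorZr h scaler0.
  - by rewrite associatorDm h1 h2 addr0.
  - by rewrite associatorZm h scaler0.
split=> // p q; first by rewrite associatorCl // A oppr0.
by rewrite associator_rot.
Qed.
End CentralityCriterion.

(** * The Cayley-Dickson doubling *)

Section Doubling.
Variables (K : fieldType) (Q : falgType K) (c : conjugation Q) (gamma : K).
Local Notation D := (cayley_dickson c gamma).

Lemma conj_traceE q : exists k, q + c q = k%:A.
Proof. by have /vlineP := conj_trace c q. Qed.

Lemma conj_normE q : exists k, q * c q = k%:A.
Proof. by have /vlineP := conj_norm c q. Qed.

Lemma conj_comm q : c q * q = q * c q.
Proof.
have [k e] := conj_traceE q.
have -> : c q = k%:A - q by rewrite -e addrAC subrr add0r.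
by rewrite mulrBl mulrBr mulr_algl mulr_algr.
Qed.

Lemma conj_trace_mulC (p q : Q) : p * q + c (p * q) = q * p + c (q * p).
Proof.
have [k e] := conj_traceE p; have [l f] := conj_traceE q.
rewrite !conjM.
have -> : c p = k%:A - p by rewrite -e addrAC subrr add0r.
have -> : c q = l%:A - q by rewrite -f addrAC subrr add0r.
rewrite !mulrBl !mulrBr !mulr_algl !mulr_algr.
rewrite ![k *: l%:A]scalerA ![l *: k%:A]scalerA [k * l]mulrC.
by zmod.
Qed.

HB.instance Definition _ := GRing.Lmodule.on D.

Fact cd_scalerAl (a : K) (x y : D) : a *: (x ** y) = (a *: x) ** y.
Proof.
congr (_, _) => /=.
  by rewrite scalerDr scalerAl !scalerA [a * _]mulrC -!scalerA scalerAr.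
by rewrite scalerDr scalerAr scalerAl.
Qed.
Fact cd_scalerAr (a : K) (x y : D) : a *: (x ** y) = x ** (a *: y).
Proof.
congr (_, _) => /=; rewrite linearZ /= scalerDr.
  by rewrite scalerAr -!scalerAl !scalerA mulrC.
by rewrite scalerAl scalerAr.
Qed.

HB.instance Definition _ := NARing_isNAAlgebra.Build K D cd_scalerAl cd_scalerAr.

Lemma cd_mulll (p q : Q) : ((p, 0) : D) ** ((q, 0) : D) = (p * q, 0).
Proof.
congr (_, _); rewrite /= ?linear0 ?mulr0 ?scaler0 ?addr0 //.
by rewrite !mul0r addr0.
Qed.
Lemma cd_mullr (p q : Q) : ((p, 0) : D) ** ((0, q) : D) = (0, q * p).
Proof.
by congr (_, _); rewrite /= ?linear0 ?(mulr0, mul0r, scaler0, addr0).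
Qed.
Lemma cd_mulrl (p q : Q) : ((0, p) : D) ** ((q, 0) : D) = (0, p * c q).
Proof.
by congr (_, _); rewrite /= ?linear0 ?(mulr0, mul0r, scaler0, addr0, add0r).
Qed.

(** Once conj a is written as tr a - a and the norms are recognized as scalars,
    both alternative laws become identities in the associative algebra Q. *)
Lemma cd_alternative : na_alternative D.
Proof.
move=> [a b] [p q].
have [k ek] := conj_traceE a; have ca : c a = k%:A - a by rewrite -ek addrC addKr.
have [l el] := conj_traceE p; have cp : c p = l%:A - p by rewrite -el addrC addKr.
have [n en] := conj_normE b; have [m em] := conj_normE q.
have en' : c b * b = n%:A by rewrite conj_comm.
have em' : c q * q = m%:A by rewrite conj_comm.
have en1 x : c b * (b * x) = n *: x by rewrite mulrA en' mulr_algl.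
have en2 x : b * (c b * x) = n *: x by rewrite mulrA en mulr_algl.
have em1 x : c q * (q * x) = m *: x by rewrite mulrA em' mulr_algl.
have em2 x : q * (c q * x) = m *: x by rewrite mulrA em mulr_algl.
pose E := (mulrDl, mulrDr, mulNr, mulrN, scalerDr, scalerN, mulr_algl,
  mulr_algr, =^~ scalerAl, =^~ scalerAr).
pose N := (en, en', em, em', en1, en2, em1, em2).
by split; apply/associator_eq0; congr (_, _) => /=;
  rewrite ?(linearD, linearZ, conjM, conjK) /= ?linearZ /= ?conjM ?conjK ?ca ?cp;
  rewrite !E -!mulrA ?N ?E; zmod.
Qed.
End Doubling.

(** In an alternative algebra, the two relations on w alone determine all
    products in Q + Q w. *)
Section DoublingEmbedding.
Variables (K : fieldType) (Q : falgType K) (c : conjugation Q) (gamma : K).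
Variables (B : naAlgType K) (iota : {linear Q -> B}) (w : B).
Hypothesis altB : na_alternative B.
Hypothesis iota1 : iota 1 = naone.
Hypothesis iotaM : forall p q, iota (p * q) = iota p ** iota q.
Hypothesis w_conj : forall q, w ** iota q = iota (c q) ** w.
Hypothesis sqw : w ** w = gamma *: naone.
Implicit Types p q : Q.

(** From (p, q, w) = - (p, w, q) and the scalar trace q + conj q. *)
Let mulrw p q : (iota p ** w) ** iota q = iota (p * c q) ** w.
Proof.
have h := associatorCr altB (iota p) (iota q) w.
rewrite /associator w_conj -iotaM in h.
have [k ek] := conj_traceE c q.
have e : iota p ** (iota q ** w) + iota p ** (iota (c q) ** w) = k *: (iota p ** w).
  rewrite -namulDr -namulDl -linearD ek linearZ /= iota1.
  by rewrite -nascalerAl namul1r nascalerAr.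
have -> : p * c q = k *: p - p * q.
  by rewrite -mulr_algr -ek mulrDr addrAC subrr add0r.
rewrite linearB linearZ /= namulDl namulNr -nascalerAl -e; zmod h.
Qed.

(** From (p, q, w) = (w, p, q) and the symmetry of the trace form. *)
Let mullw p q : iota p ** (iota q ** w) = iota (q * p) ** w.
Proof.
have h := associator_rot altB w (iota p) (iota q).
rewrite /associator w_conj -!iotaM mulrw w_conj conjM in h.
have -> : q * p = p * q + c q * c p - c p * c q.
  by rewrite -!conjM conj_trace_mulC addrK.
by rewrite linearB linearD /= namulDl namulNr namulDl; zmod h.
Qed.

(** The middle Moufang identity applied to (w (conj p)) (q w). *)
Let mulww p q : (iota p ** w) ** (iota q ** w) = gamma *: iota (c q * p).
Proof.
have -> : iota p ** w = w ** iota (c p) by rewrite w_conj conjK.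
rewrite moufang_middle // -iotaM -flexible // w_conj alt_mulr // sqw.
by rewrite -nascalerAr namulr1 conjM conjK.
Qed.

Definition doubling_map (x : cayley_dickson c gamma) : B :=
  iota x.1 + iota x.2 ** w.

Lemma doubling_map_morphism : na_morphism doubling_map.
Proof.
split=> [x y|x y|]; rewrite /doubling_map.
- by rewrite !linearD namulDl addrACA.
- rewrite !(namulDl, namulDr) mullw mulrw mulww -iotaM /=.
  rewrite !linearD namulDl linearZ /=; zmod.
- by rewrite /= iota1 linear0 namul0r addr0.
Qed.

(** If p + q w = 0, then comparing (conj r) (p + q w) with (p + q w) r gives
    (conj r) p = p r for all r. Applied to r s and s r, this says that p is
    killed by all commutators, hence p = 0, and then q = 0 because w^2 is
    invertible. *)
Lemma doubling_map_inj : injective iota -> gamma != 0 ->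
  (exists r s : Q, r * s - s * r \is a GRing.unit) -> injective doubling_map.
Proof.
move=> iota_inj gamma0 [r0 [s0 d_unit]].
have inj0 q : iota q = 0 -> q = 0.
  by move=> e; apply: iota_inj; rewrite e linear0.
have ker x : doubling_map x = 0 -> x = 0.
  case: x => p q; rewrite /doubling_map /= => e.
  have twist r : c r * p = p * r.
    apply/eqP; rewrite -subr_eq0; apply/eqP/inj0.
    have h1 : iota (c r) ** (iota p + iota q ** w) = 0 by rewrite e namulr0.
    have h2 : (iota p + iota q ** w) ** iota r = 0 by rewrite e namul0r.
    rewrite namulDr mullw -iotaM in h1; rewrite namulDl mulrw -iotaM in h2.
    by rewrite linearB /=; zmod (etrans h1 (esym h2)).
  have p0 : p = 0.
    apply: (mulIr d_unit); rewrite mul0r mulrBr.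
    by rewrite -twist conjM -mulrA twist mulrA twist -mulrA subrr.
  have q0 : q = 0.
    rewrite p0 linear0 add0r in e; apply: inj0.
    have h : (iota q ** w) ** w = 0 by rewrite e namul0r.
    rewrite alt_mulr // sqw -nascalerAr namulr1 in h.
    by apply: (scalerI gamma0); rewrite scaler0.
  by rewrite p0 q0.
move=> x y e; apply/eqP; rewrite -subr_eq0; apply/eqP/ker.
have [fD _ _] := doubling_map_morphism.
apply: (addIr (doubling_map y)); rewrite -fD.
by rewrite (_ : x - y + y = x) ?add0r // subrK.
Qed.
End DoublingEmbedding.

(** * Quaternion algebras *)

(** Coordinates in the basis 1, x, y, u = x y, where x^2 = a, y^2 = b and
    x y + y x = 1. This presentation is uniform in the characteristic; the
    algebra is quaternion exactly when 1 - 4ab is invertible. *)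
Record quat (K : fieldType) (a b : K) :=
  Quat { quat0 : K; quat1 : K; quat2 : K; quat3 : K }.

Section Quaternion.
Variables (K : fieldType) (a b : K).
Local Notation Q := (quat a b).
Local Notation mkq := (@Quat K a b).

Definition row_of_quat (p : Q) : 'rV[K]_4 :=
  \row_i [:: quat0 p; quat1 p; quat2 p; quat3 p]`_i.
Definition quat_of_row (v : 'rV[K]_4) : Q :=
  mkq (v 0 0) (v 0 1) (v 0 2) (v 0 3).
Fact row_of_quatK : cancel row_of_quat quat_of_row.
Proof. by case=> p0 p1 p2 p3; rewrite /quat_of_row !mxE. Qed.
Fact quat_of_rowK : cancel quat_of_row row_of_quat.
Proof.
move=> v; apply/rowP=> i; rewrite mxE /=.
by case: i => [[|[|[|[|i]]]] lt_i] //=; congr (v _ _); apply: val_inj.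
Qed.

HB.instance Definition _ := Choice.copy Q (can_type row_of_quatK).

Definition quat_add (p q : Q) : Q :=
  mkq (quat0 p + quat0 q) (quat1 p + quat1 q)
      (quat2 p + quat2 q) (quat3 p + quat3 q).
Definition quat_opp (p : Q) : Q :=
  mkq (- quat0 p) (- quat1 p) (- quat2 p) (- quat3 p).
Definition quat_scale (k : K) (p : Q) : Q :=
  mkq (k * quat0 p) (k * quat1 p) (k * quat2 p) (k * quat3 p).
Definition quat_mul (p q : Q) : Q :=
  let: Quat p0 p1 p2 p3 := p in let: Quat q0 q1 q2 q3 := q in
  mkq
    (p0 * q0 + a * (p1 * q1) + b * (p2 * q2) + p2 * q1 - a * b * (p3 * q3))
    (p0 * q1 + p1 * q0 - b * (p2 * q3) + b * (p3 * q2) + p3 * q1)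
    (p0 * q2 + p2 * q0 + a * (p1 * q3) - a * (p3 * q1) + p2 * q3)
    (p0 * q3 + p3 * q0 + p1 * q2 - p2 * q1 + p3 * q3).
Definition quat_conj (p : Q) : Q :=
  let: Quat p0 p1 p2 p3 := p in mkq (p0 + p3) (- p1) (- p2) (- p3).

Ltac quat_fact := repeat case=> ? ? ? ?;
  rewrite /quat_add /quat_scale /quat_opp /quat_mul /=; congr Quat; ring.

Fact quat_addA : associative quat_add. Proof. quat_fact. Qed.
Fact quat_addC : commutative quat_add. Proof. quat_fact. Qed.
Fact quat_add0 : left_id (mkq 0 0 0 0) quat_add. Proof. quat_fact. Qed.
Fact quat_addN : left_inverse (mkq 0 0 0 0) quat_opp quat_add.
Proof. quat_fact. Qed.
HB.instance Definition _ :=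
  GRing.isZmodule.Build Q quat_addA quat_addC quat_add0 quat_addN.

Lemma quat_addE p q : p + q = quat_add p q :> Q. Proof. by []. Qed.
Lemma quat_oppE p : - p = quat_opp p :> Q. Proof. by []. Qed.

Fact quat_mulA : associative quat_mul. Proof. quat_fact. Qed.
Fact quat_mul1 : left_id (mkq 1 0 0 0) quat_mul. Proof. quat_fact. Qed.
Fact quat_mulr1 : right_id (mkq 1 0 0 0) quat_mul. Proof. quat_fact. Qed.
Fact quat_mulDl : left_distributive quat_mul +%R.
Proof. by move=> p q r; rewrite !quat_addE; move: p q r; quat_fact. Qed.
Fact quat_mulDr : right_distributive quat_mul +%R.
Proof. by move=> p q r; rewrite !quat_addE; move: p q r; quat_fact. Qed.
Fact quat_one_neq0 : mkq 1 0 0 0 != 0.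
Proof. by apply/eqP => -[/eqP]; rewrite oner_eq0. Qed.
HB.instance Definition _ := GRing.Zmodule_isNzRing.Build Q
  quat_mulA quat_mul1 quat_mulr1 quat_mulDl quat_mulDr quat_one_neq0.

Fact quat_scaleA k l (p : Q) : quat_scale k (quat_scale l p) = quat_scale (k * l) p.
Proof. by move: p; quat_fact. Qed.
Fact quat_scale1 : left_id 1 quat_scale. Proof. quat_fact. Qed.
Fact quat_scaleDr : right_distributive quat_scale +%R.
Proof. by move=> k p q; rewrite !quat_addE; move: p q; quat_fact. Qed.
Fact quat_scaleDl (p : Q) : {morph quat_scale^~ p : k l / k + l}.
Proof. by move=> k l; rewrite quat_addE; move: p; quat_fact. Qed.
HB.instance Definition _ := GRing.Zmodule_isLmodule.Build K Q
  quat_scaleA quat_scale1 quat_scaleDr quat_scaleDl.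

Lemma quat_scaleE k (p : Q) : k *: p = quat_scale k p. Proof. by []. Qed.
Lemma quat_mulE (p q : Q) : p * q = quat_mul p q. Proof. by []. Qed.
Lemma quat_oneE : 1 = mkq 1 0 0 0. Proof. by []. Qed.

Ltac quat_alg :=
  rewrite ?mulr2n ?(quat_addE, quat_oppE, quat_scaleE, quat_mulE) ?quat_oneE;
  repeat match goal with p : quat _ _ |- _ => move: p end; quat_fact.

Fact quat_scalerAl k (p q : Q) : k *: (p * q) = (k *: p) * q.
Proof. quat_alg. Qed.
HB.instance Definition _ := GRing.Lmodule_isLalgebra.Build K Q quat_scalerAl.
Fact quat_scalerAr k (p q : Q) : k *: (p * q) = p * (k *: q).
Proof. quat_alg. Qed.
HB.instance Definition _ := GRing.Lalgebra_isAlgebra.Build K Q quat_scalerAr.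

Fact row_of_quat_linear : linear row_of_quat.
Proof.
move=> k p q; apply/rowP=> i; rewrite !mxE.
by case: i => [[|[|[|[|i]]]] lt_i].
Qed.
Fact quat_vector : Vector.axiom 4 Q.
Proof.
exists row_of_quat; first exact: row_of_quat_linear.
by exists quat_of_row; [exact: row_of_quatK | exact: quat_of_rowK].
Qed.
HB.instance Definition _ := Lmodule_hasFinDim.Build K Q quat_vector.
HB.instance Definition _ := Algebra_isFalgebra.Build K Q.

Lemma dim_quat : \dim {:Q} = 4%N.
Proof. by rewrite dimvf. Qed.

Fact quat_conj_linear : linear quat_conj.
Proof. move=> k [? ? ? ?] [? ? ? ?]; quat_alg. Qed.
HB.instance Definition _ := GRing.isLinear.Build K Q Q _ quat_conj quat_conj_linear.

Fact quat_conjM (p q : Q) : quat_conj (p * q) = quat_conj q * quat_conj p.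
Proof. quat_alg. Qed.
Fact quat_conjK : involutive quat_conj.
Proof. quat_fact. Qed.

Lemma quat_scalarE k : k%:A = mkq k 0 0 0.
Proof. quat_alg. Qed.

Definition quat_trace (p : Q) : K := quat0 p *+ 2 + quat3 p.

Fact quat_conj_trace (p : Q) : p + quat_conj p \in 1%VS.
Proof.
apply/vlineP; exists (quat_trace p); rewrite quat_scalarE /quat_trace; quat_alg.
Qed.
Fact quat_conj_norm (p : Q) : p * quat_conj p \in 1%VS.
Proof.
case: p => p0 p1 p2 p3; apply/vlineP.
exists (p0 ^+ 2 + p0 * p3 + a * b * p3 ^+ 2 - a * p1 ^+ 2 - b * p2 ^+ 2 - p1 * p2).
rewrite quat_scalarE; quat_alg.
Qed.

Definition quat_conjugation : conjugation Q :=
  Conjugation quat_conjM quat_conjK quat_conj_trace quat_conj_norm.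

Definition quat_x : Q := mkq 0 1 0 0.
Definition quat_y : Q := mkq 0 0 1 0.
Definition quat_u : Q := mkq 0 0 0 1.

Lemma quat_mul_xy : quat_x * quat_y = quat_u.
Proof. rewrite /quat_x /quat_y /quat_u; quat_alg. Qed.
Lemma quat_conj_u : quat_conj quat_u = 1 - quat_u.
Proof. rewrite /quat_u; quat_alg. Qed.

Hypothesis disc_neq0 : 1 - a * b *+ 4 != 0.

(** The Gram matrix of the trace form splits into the blocks (1, u) and (x, y),
    of determinants 1 - 4ab and 4ab - 1; the coefficients below come from the
    adjugates of these blocks. *)
Lemma quat_trace_form_nondegenerate p :
  (forall r, quat_trace (p * r) = 0) -> p = 0.
Proof.
case: p => p0 p1 p2 p3 h.
have := h 1; have := h quat_x; have := h quat_y; have := h quat_u.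
rewrite quat_oneE !quat_mulE /quat_trace /= => h3 h2 h1 h0.
have D k l m i j : l = 0 -> m = 0 -> (1 - a * b *+ 4) * k = i * l + j * m -> k = 0.
  move=> -> -> /eqP.
  by rewrite !mulr0 addr0 mulf_eq0 (negbTE disc_neq0) => /eqP.
congr Quat.
- by apply: (D _ _ _ (1 - a * b *+ 2) (-1) h0 h3); ring.
- by apply: (D _ _ _ (- (b *+ 2)) 1 h1 h2); ring.
- by apply: (D _ _ _ 1 (- (a *+ 2)) h1 h2); ring.
- by apply: (D _ _ _ (-1) 2%:R h0 h3); ring.
Qed.

(** The identity that the sum of e q e' over a basis e and its dual basis e' for
    the trace form is the trace of q, multiplied by the discriminant. *)
Lemma quat_trace_sum (q : Q) :
  (1 - a * b *+ 4) *: (quat_trace q)%:A =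
    q * ((1 - a * b *+ 2)%:A - quat_u) + quat_u * q * (quat_u *+ 2 - 1) +
    quat_x * q * (quat_y - (b *+ 2) *: quat_x) +
    quat_y * q * (quat_x - (a *+ 2) *: quat_y).
Proof.
rewrite !quat_scalarE /quat_trace /quat_u /quat_x /quat_y; quat_alg.
Qed.

(** By [quat_trace_sum] a two-sided ideal contains the trace of each of its
    elements, and by nondegeneracy some trace of a multiple of q is nonzero. *)
Lemma quat_ideal (J : Q -> Prop) q :
  (forall p r, J p -> J r -> J (p + r)) ->
  (forall p r, J r -> J (p * r)) -> (forall p r, J p -> J (p * r)) ->
  J q -> q != 0 -> J 1.
Proof.
move=> JD JMl JMr Jq q0.
have JZ k p : J p -> J (k *: p) by move=> Jp; rewrite -mulr_algl; apply: JMl.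
have Jtrace r : J ((1 - a * b *+ 4) *: (quat_trace (q * r))%:A).
  have Jqr : J (q * r) by apply: JMr.
  by rewrite quat_trace_sum; do ?[apply: (JD)]; apply: (JMr) => //; apply: (JMl).
case: (pselect (exists r, quat_trace (q * r) != 0)) => [[r tr0]|no].
  move: (JZ (quat_trace (q * r))^-1 _ (JZ (1 - a * b *+ 4)^-1 _ (Jtrace r))).
  by rewrite !scalerA divfK // mulVf // scale1r.
case/eqP: q0; apply: quat_trace_form_nondegenerate => r.
by apply/eqP; apply: contra_notT no => tr0; exists r.
Qed.

Lemma quat_center_scalar (p : Q) :
  p * quat_x = quat_x * p -> p * quat_y = quat_y * p -> exists k, p = k%:A.
Proof.
case: p => p0 p1 p2 p3; rewrite !quat_mulE /= => -[e1 e2 _ _] [e3 _ _ _].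
by exists p0; rewrite quat_scalarE; congr Quat;
  [ apply: (eq_of_sub_eq (esym e3)) | apply: (eq_of_sub_eq e1)
  | apply: (eq_of_sub_eq e2)]; ring.
Qed.

Lemma quat_is_quaternion : is_quaternion Q.
Proof.
split; last exact: dim_quat.
  apply/vspaceP=> p; apply/idP/idP; last first.
    case/vlineP=> k ->; rewrite memv_cap memvf /=.
    by apply/centvP=> q _; rewrite mulr_algl mulr_algr.
  rewrite memv_cap memvf /= => /centvP cp.
  have [k ->] := quat_center_scalar (cp _ (memvf _)) (cp _ (memvf _)).
  by apply/vlineP; exists k.
move=> I Il Ir; have [->|/eqP I0] := I =P 0%VS; [by left|right].
have I1 : 1 \in I.
  apply: (@quat_ideal (fun p => p \in I) (vpick I)); last by rewrite vpick0.
  - by move=> p r; apply: memvD.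
  - by move=> p r Ir'; apply: (subvP Il); apply: memv_mul => //; exact: memvf.
  - by move=> p r Ip; apply: (subvP Ir); apply: memv_mul => //; exact: memvf.
  - exact: memv_pick.
apply/eqP; rewrite eqEsubv subvf; apply/subvP=> p _.
by rewrite -[p]mul1r; apply: (subvP Ir); apply: memv_mul => //; exact: memvf.
Qed.

Lemma quat_commutator_unit :
  quat_x * quat_y - quat_y * quat_x \is a GRing.unit.
Proof.
set d := _ - _; have d2 : d * d = (1 - a * b *+ 4)%:A.
  by rewrite quat_scalarE /d /quat_x /quat_y; quat_alg.
apply/unitrP; exists ((1 - a * b *+ 4)^-1 *: d).
by rewrite -scalerAl -scalerAr d2 scalerA mulVf // scale1r.
Qed.

Section QuaternionMap.
Variables (B : naAlgType K) (x y : B).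
Hypothesis altB : na_alternative B.
Hypotheses (sqx : x ** x = a *: naone) (sqy : y ** y = b *: naone).
Hypothesis jxy : x ** y + y ** x = naone.

Definition quat_map (p : Q) : B :=
  quat0 p *: naone + quat1 p *: x + quat2 p *: y + quat3 p *: (x ** y).

Fact quat_map_linear : linear quat_map.
Proof.
move=> k [p0 p1 p2 p3] [q0 q1 q2 q3]; rewrite /quat_map /=.
by lmod.
Qed.
HB.instance Definition _ := GRing.isLinear.Build K Q B _ quat_map quat_map_linear.

Lemma quat_map1 : quat_map 1 = naone.
Proof. by rewrite /quat_map /= scale1r !scale0r !addr0. Qed.

Let u := x ** y.

Lemma quat_relations :
  [/\ y ** x = naone - u, x ** u = a *: y, u ** x = x - a *: y,
      y ** u = y - b *: x & u ** y = b *: x] /\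
  u ** u = u - (a * b) *: naone.
Proof.
have yx : y ** x = naone - u by zmod jxy.
have xu : x ** u = a *: y by rewrite /u alt_mull // sqx -nascalerAl namul1r.
have uy : u ** y = b *: x by rewrite /u alt_mulr // sqy -nascalerAr namulr1.
have ux : u ** x = x - a *: y.
  by rewrite /u flexible // yx namulDr namulr1 namulrN xu.
have yu : y ** u = y - b *: x.
  by rewrite /u -flexible // yx namulDl namul1r namulNr uy.
split=> //.
have /associator_eq0 e : associator x y u = 0.
  rewrite -associator_rot // -associator_rot // associatorCl //.
  by rewrite /u associator_ppq // associator_abb // namul0r oppr0.
by rewrite {1}/u e yu namulDr namulrN -nascalerAr sqx scalerA mulrC.
Qed.

Lemma quat_mapM (p q : Q) : quat_map (p * q) = quat_map p ** quat_map q.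
Proof.
have [[yx xu ux yu uy] uu] := quat_relations.
case: p => p0 p1 p2 p3; case: q => q0 q1 q2 q3; rewrite /quat_map -/u /=.
rewrite !(namulDl, namulDr) -!(nascalerAl, nascalerAr).
rewrite !namul1r !namulr1.
rewrite sqx sqy yx xu uy ux yu uu.
by lmod.
Qed.

Lemma quat_map_inj : naone != 0 :> B -> injective quat_map.
Proof.
move=> B1 p q e; apply/eqP; rewrite -subr_eq0; apply: contraNT B1 => pq0.
rewrite -quat_map1; apply/eqP.
apply: (@quat_ideal (fun r => quat_map r = 0) (p - q)) => //.
- by move=> r s e1 e2; rewrite linearD /= e1 e2 addr0.
- by move=> r s e1; rewrite quat_mapM e1 namulr0.
- by move=> r s e1; rewrite quat_mapM e1 namul0r.
- by rewrite linearB /= e subrr.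
Qed.

Variables (c t : K) (z : B).
Hypotheses (sqz : z ** z = c *: naone) (jxz : x ** z + z ** x = 0).
Hypotheses (jyz : y ** z + z ** y = 0) (juz : u ** z + z ** u - z = t *: naone).

Let disc : K := 1 - a * b *+ 4.

(** The component of z orthogonal to the quaternions. The coefficient
    t / (1 - 4ab) is the only one for which w u = (conj u) w. *)
Definition doubling_elt : B := z - (t / disc) *: (u *+ 2 - naone).
Definition doubling_const : K := c - t ^+ 2 / disc.

Lemma doubling_elt_conj q :
  doubling_elt ** quat_map q = quat_map (quat_conj q) ** doubling_elt.
Proof.
have [[yx xu ux yu uy] uu] := quat_relations.
rewrite /doubling_elt; set s := t / disc.
have st : t = s * disc by rewrite divfK.
case: q => p0 p1 p2 p3; rewrite /quat_map -/u /=.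
have zx : z ** x = - (x ** z) by zmod jxz.
have zy : z ** y = - (y ** z) by zmod jyz.
have zu : z ** u = z + t *: naone - u ** z by zmod juz.
rewrite mulr2n; do !rewrite !(namulDl, namulDr, namulNr, namulrN,
  =^~ nascalerAl, =^~ nascalerAr).
rewrite !namul1r !namulr1 zx zy zu xu ux yu uy uu st /disc.
by lmod.
Qed.

Lemma doubling_elt_sq : doubling_elt ** doubling_elt = doubling_const *: naone.
Proof.
have [_ uu] := quat_relations.
rewrite /doubling_elt /doubling_const; set s := t / disc.
have st : t = s * disc by rewrite divfK.
have zu : z ** u = z + t *: naone - u ** z by zmod juz.
have -> : t ^+ 2 / disc = s ^+ 2 * disc.
  by rewrite st exprMn expr2 [disc ^+ 2]expr2 mulrA mulfK.
rewrite mulr2n; do !rewrite !(namulDl, namulDr, namulNr, namulrN,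
  =^~ nascalerAl, =^~ nascalerAr).
rewrite !namul1r !namulr1 zu uu sqz st /disc.
by lmod.
Qed.
End QuaternionMap.
End Quaternion.

(** * The center of a simple ring *)

Section CenterClosure.
Variable R : naRingType.
Implicit Types a b r s : R.

Lemma central_mulA a r s : na_central a -> a ** (r ** s) = (a ** r) ** s.
Proof. by case=> /(_ r s) /associator_eq0 ->. Qed.
Lemma central_mulCA a r s : na_central a -> r ** (a ** s) = a ** (r ** s).
Proof.
move=> ca; case: (ca) => _ /(_ r s) /associator_eq0 <- _ aC.
by rewrite -aC central_mulA.
Qed.

Lemma na_centralD a b : na_central a -> na_central b -> na_central (a + b).
Proof.
move=> [a1 a2 a3 a4] [b1 b2 b3 b4].
by split=> *; rewrite ?(associatorDl, associatorDm, associatorDr) ?(a1, a2, a3)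
  ?(b1, b2, b3) ?addr0 // namulDl namulDr a4 b4.
Qed.

Lemma na_centralN a : na_central a -> na_central (- a).
Proof.
move=> [a1 a2 a3 a4].
by split=> *; rewrite ?(associatorNl, associatorNm, associatorNr) ?(a1, a2, a3)
  ?oppr0 // namulNr namulrN a4.
Qed.

Lemma na_centralM a b : na_central a -> na_central b -> na_central (a ** b).
Proof.
have out c : na_central c ->
    (forall r s, (c ** r) ** s = c ** (r ** s)) *
    (forall r s, r ** (c ** s) = c ** (r ** s)).
  by move=> cc; split=> r s; [rewrite central_mulA | rewrite central_mulCA].
move=> ca cb; have [_ _ _ aC] := ca; have [_ _ _ bC] := cb.
split=> [x y|x y|x y|x]; rewrite ?associator_eq0 !(out a ca).
- by rewrite !(out b cb).
- by rewrite -!bC !(out b cb).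
- by rewrite -!bC !(out b cb).
- by rewrite -!bC !(out b cb).
Qed.

Lemma na_central_inv a b : na_central a -> a ** b = naone -> na_central b.
Proof.
move=> ca ab; have [_ _ _ aC] := ca.
have K r : b ** (a ** r) = r.
  by rewrite central_mulCA // central_mulA // ab namul1r.
have inj r s : a ** r = a ** s -> r = s by move=> e; rewrite -(K r) e K.
have ba r : a ** (b ** r) = r by rewrite central_mulA // ab namul1r.
have rb r : a ** (r ** b) = r by rewrite -central_mulCA // ab namulr1.
split=> [x y|x y|x y|x]; rewrite ?associator_eq0; apply: inj.
- by rewrite central_mulA // !ba.
- by rewrite central_mulA // rb -central_mulCA // ba.
- by rewrite rb -central_mulCA // rb.
- by rewrite ba rb.
Qed.
End CenterClosure.

Section PrincipalIdeal.
Variables (A : naRingType) (a : A) (ca : na_central a).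

Definition central_ideal : {pred A} := fun x => `[<exists r, x = a ** r>].

Fact central_ideal_zmod : zmod_closed central_ideal.
Proof.
split=> [|x y /asboolP[r ->] /asboolP[s ->]]; apply/asboolP.
  by exists 0; rewrite namulr0.
by exists (r - s); rewrite namulDr namulrN.
Qed.
HB.instance Definition _ :=
  GRing.isZmodClosed.Build A central_ideal central_ideal_zmod.

Fact central_idealMl (x y : A) : y \in central_ideal -> x ** y \in central_ideal.
Proof.
by move=> /asboolP[r ->]; apply/asboolP; exists (x ** r); rewrite central_mulCA.
Qed.
Fact central_idealMr (x y : A) : x \in central_ideal -> x ** y \in central_ideal.
Proof.
by move=> /asboolP[r ->]; apply/asboolP; exists (r ** y); rewrite central_mulA.
Qed.
HB.instance Definition _ :=
  isNAIdeal.Build A central_ideal central_idealMl central_idealMr.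

Lemma simple_central_inv : na_simple A -> a != 0 -> exists b, a ** b = naone.
Proof.
case=> _ /(_ central_ideal) [I0|IT] a0.
  by case/eqP: a0; apply: I0; apply/asboolP; exists naone; rewrite namulr1.
by have /asboolP[b ->] := IT naone; exists b.
Qed.
End PrincipalIdeal.

Record center (A : naRingType) (simpleA : na_simple A) :=
  Center { center_val :> A; _ : `[<na_central center_val>] }.

(** A copy of A that carries its structure of algebra over its center. *)
Definition central_algebra (A : naRingType) (simpleA : na_simple A) : Type := A.

Section CenterField.
Variables (A : naRingType) (simpleA : na_simple A).
Local Notation K := (center simpleA).

HB.instance Definition _ := [isSub of K for @center_val A simpleA].
HB.instance Definition _ := [Choice of K by <:].

Lemma centerP (k : K) : na_central (k : A).
Proof. by apply/asboolP; case: k. Qed.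

Definition mk_center a (ca : na_central a) : K :=
  Center simpleA (introT (asboolP _) ca).

Definition center_add (k l : K) := mk_center (na_centralD (centerP k) (centerP l)).
Definition center_opp (k : K) := mk_center (na_centralN (centerP k)).
Definition center_mul (k l : K) := mk_center (na_centralM (centerP k) (centerP l)).
Definition center_zero : K := mk_center (na_central0 A).
Definition center_one : K := mk_center (na_central1 A).

Fact center_addA : associative center_add.
Proof. by move=> x y z; apply: val_inj; rewrite /= addrA. Qed.
Fact center_addC : commutative center_add.
Proof. by move=> x y; apply: val_inj; rewrite /= addrC. Qed.
Fact center_add0 : left_id center_zero center_add.
Proof. by move=> x; apply: val_inj; rewrite /= add0r. Qed.
Fact center_addN : left_inverse center_zero center_opp center_add.
Proof. by move=> x; apply: val_inj; rewrite /= addNr. Qed.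
HB.instance Definition _ :=
  GRing.isZmodule.Build K center_addA center_addC center_add0 center_addN.

Fact center_mulA : associative center_mul.
Proof.
by move=> x y z; apply: val_inj; rewrite /= (central_mulA _ _ (centerP x)).
Qed.
Fact center_mulC : commutative center_mul.
Proof. by move=> x y; apply: val_inj; case: (centerP x) => _ _ _; apply. Qed.
Fact center_mul1 : left_id center_one center_mul.
Proof. by move=> x; apply: val_inj; rewrite /= namul1r. Qed.
Fact center_mulDl : left_distributive center_mul +%R.
Proof. by move=> x y z; apply: val_inj; rewrite /= namulDl. Qed.
Fact center_one_neq0 : center_one != 0.
Proof. by case: simpleA => A1 _; apply: contra_neq A1 => /(congr1 val). Qed.
HB.instance Definition _ := GRing.Zmodule_isComNzRing.Build K
  center_mulA center_mulC center_mul1 center_mulDl center_one_neq0.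

Lemma center_val_eq0 (k : K) : (k == 0) = (val k == 0).
Proof. by rewrite -val_eqE. Qed.

Fact center_inv_ex (k : K) :
  exists l : K, (k != 0 -> l * k = 1) /\ (k = 0 -> l = 0).
Proof.
have [->|k0] := eqVneq k 0; first by exists 0.
have kv0 := k0; rewrite center_val_eq0 in kv0.
have [b ab] := simple_central_inv (centerP k) simpleA kv0.
exists (mk_center (na_central_inv (centerP k) ab)); split=> [_|/eqP].
  by rewrite mulrC; apply: val_inj.
by rewrite (negbTE k0).
Qed.
Definition center_inv (k : K) : K := sval (cid (center_inv_ex k)).
Fact center_mulVf (k : K) : k != 0 -> center_inv k * k = 1.
Proof. by rewrite /center_inv; case: cid => l []. Qed.
Fact center_inv0 : center_inv 0 = 0.
Proof. by rewrite /center_inv; case: cid => l /= [_]; apply. Qed.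
HB.instance Definition _ :=
  GRing.ComNzRing_isField.Build K center_mulVf center_inv0.

Local Notation B := (central_algebra simpleA).
HB.instance Definition _ := NARing.copy B A.
Definition center_scale (k : K) (r : B) : B := (k : A) ** (r : A).
Fact center_scaleA k l r :
  center_scale k (center_scale l r) = center_scale (k * l) r.
Proof. exact: (central_mulA _ _ (centerP k)). Qed.
Fact center_scale1 : left_id 1 center_scale.
Proof. by move=> r; apply: namul1r. Qed.
Fact center_scaleDr : right_distributive center_scale +%R.
Proof. by move=> k r s; apply: namulDr. Qed.
Fact center_scaleDl r : {morph center_scale^~ r : k l / k + l}.
Proof. by move=> k l; apply: namulDl. Qed.
HB.instance Definition _ := GRing.Zmodule_isLmodule.Build K B
  center_scaleA center_scale1 center_scaleDr center_scaleDl.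
Fact center_scalerAl (k : K) (r s : B) : k *: (r ** s) = (k *: r) ** s.
Proof. exact: (central_mulA _ _ (centerP k)). Qed.
Fact center_scalerAr (k : K) (r s : B) : k *: (r ** s) = r ** (k *: s).
Proof. exact/esym/(central_mulCA _ _ (centerP k)). Qed.
HB.instance Definition _ :=
  NARing_isNAAlgebra.Build K B center_scalerAl center_scalerAr.

End CenterField.

(** * Ternary quadratic forms *)

Section TernaryForm.
Variables (F : fieldType) (V : vectType F) (phi : V -> F).
Hypotheses (quad : quadratic_form phi) (dimV : \dim {:V} = 3%N).
Hypothesis nondeg : nondegenerate_form phi.
Local Notation B := (polar phi).

Lemma polarC v w : B v w = B w v.
Proof. by rewrite /polar [v + w]addrC; ring. Qed.

Lemma polarDZl k v v' w : B (k *: v + v') w = k * B v w + B v' w.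
Proof. by case: quad => _ /(_ w) /(_ k v v'). Qed.
Lemma polar0l w : B 0 w = 0.
Proof. by have := polarDZl 1 0 0 w; rewrite scaler0 addr0 mul1r => h; zmod h. Qed.
Lemma polarZl k v w : B (k *: v) w = k * B v w.
Proof. by rewrite -{1}[k *: v]addr0 polarDZl polar0l addr0. Qed.
Lemma polarDl v v' w : B (v + v') w = B v w + B v' w.
Proof. by rewrite -{1}[v]scale1r polarDZl mul1r. Qed.
Lemma polar_self v : B v v = phi v *+ 2.
Proof.
have e : v + v = 2%:R *: v by rewrite scaler_nat mulr2n.
by rewrite /polar e (proj1 quad); ring.
Qed.
Lemma quadZ k v : phi (k *: v) = k ^+ 2 * phi v. Proof. exact: (proj1 quad). Qed.
Lemma quadD v w : phi (v + w) = phi v + phi w + B v w.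
Proof. by rewrite /polar; ring. Qed.

Definition pair_disc x y := B x y ^+ 2 - phi x * phi y *+ 4.

Definition polar_map w (v : V) : F^o := B v w.
Fact polar_map_linear w : linear (polar_map w).
Proof. by move=> k v v'; apply: polarDZl. Qed.
HB.instance Definition _ w :=
  GRing.isLinear.Build F V F^o _ (polar_map w) (polar_map_linear w).

Lemma polar_kernel w : exists2 U : {vspace V}, (2 <= \dim U)%N &
  forall v, v \in U -> B v w = 0.
Proof.
exists (lker (linfun (polar_map w))).
  have := limg_ker_dim (linfun (polar_map w)) {:V}.
  rewrite dimV capfv => e.
  have : (\dim (limg (linfun (polar_map w))) <= \dim {:F^o})%N.
    by apply: dimvS; apply: subvf.
  rewrite dimvf (_ : dim F^o = 1%N) // => le1; lia.
by move=> v; rewrite memv_ker lfunE => /eqP.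
Qed.

Lemma nonradical_vector (U : {vspace V}) : (2 <= \dim U)%N ->
  exists2 v, v \in U & exists w, B v w != 0.
Proof.
case: nondeg => R Rrad [dimR _] dimU.
have /subvPn[v vU vR] : ~~ (U <= R)%VS.
  by apply/negP=> /dimvS; lia.
exists v => //; apply: contrapT => no.
case/negP: vR; apply/Rrad => w; apply/eqP; apply: contra_notT no => h.
by exists w.
Qed.

(** If all discriminants vanish, every vector outside the radical satisfies
    4 phi v <> 0, since it pairs nontrivially with some vector. The orthogonal of
    such a v still has dimension at least 2, so it contains another vector w
    outside the radical, and the discriminant of (w, v) is -4 phi w phi v. *)
Lemma nondegenerate_pair : exists x y, pair_disc x y != 0.
Proof.
apply: contrapT => no.
have disc0 x y : pair_disc x y = 0.
  by apply/eqP; apply: contra_notT no => h; exists x, y.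
have nz U : (2 <= \dim U)%N -> exists2 v, v \in U & (phi v *+ 4 != 0).
  move=> /nonradical_vector[v vU [w Bvw]]; exists v => //.
  apply: contra_neq Bvw => e.
  have := disc0 v w; rewrite /pair_disc -mulrnAl e mul0r subr0 => /eqP.
  by rewrite expf_eq0 /= => /eqP.
have [v _ v0] : exists2 v, v \in {:V}%VS & phi v *+ 4 != 0.
  by apply: nz; rewrite dimV.
have [U dimU BU] := polar_kernel v.
have [w wU w0] := nz U dimU.
have := disc0 w v; rewrite /pair_disc BU // expr0n /= sub0r => /eqP.
rewrite oppr_eq0 -mulrnAl mulf_eq0 (negbTE w0) /= => /eqP e.
by case/eqP: v0; rewrite e mul0rn.
Qed.

(** Rescaling y makes B x y = 1. If B x y = 0 then 2 phi x is nonzero, and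
    replacing y by x + y, which preserves the discriminant, reduces to the
    previous case. *)
Lemma normalized_pair : exists x y, B x y = 1 /\ 1 - phi x * phi y *+ 4 != 0.
Proof.
have [x [y d]] := nondegenerate_pair.
wlog e : y d / B x y != 0.
  move=> H; have [e0|] := eqVneq (B x y) 0; last exact: H.
  have BxD : B x (x + y) = phi x *+ 2.
    by rewrite polarC polarDl polar_self (polarC y x) e0 addr0.
  apply: (H (x + y)); rewrite ?BxD.
    apply: contra_neq d; rewrite /pair_disc BxD quadD e0 => h.
    by rewrite -[RHS]h; ring.
  apply: contra_neq d => h; rewrite /pair_disc e0.
  have -> : phi x * phi y *+ 4 = (phi x *+ 2) * (phi y *+ 2) by ring.
  by rewrite h; ring.
exists x, ((B x y)^-1 *: y).
rewrite polarC polarZl (polarC y x) mulVf //; split=> //.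
rewrite quadZ; apply: contra_neq d => h; rewrite /pair_disc.
have : B x y ^+ 2 * (1 - phi x * ((B x y)^-1 ^+ 2 * phi y) *+ 4) = 0.
  by rewrite h mulr0.
by move=> e'; rewrite -[RHS]e'; field.
Qed.

Lemma basis3_expand (x y z v : V) : basis_of {:V} [:: x; y; z] ->
  exists k l m, v = k *: x + l *: y + m *: z.
Proof.
move=> bas; have := @coord_basis _ _ _ _ [tuple x; y; z] v bas (memvf v).
rewrite !big_ord_recl big_ord0 /= addr0 addrA => e.
by do 3!eexists; exact: e.
Qed.

(** z spans the orthogonal of x and y. It cannot be isotropic, since it would
    then lie in the radical. *)
Lemma ternary_basis : exists x y z : V,
  [/\ [/\ B x y = 1, B x z = 0 & B y z = 0],
    1 - phi x * phi y *+ 4 != 0, phi z != 0 & basis_of {:V} [:: x; y; z]].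
Proof.
have [x [y [Bxy d]]] := normalized_pair.
have [U dimU BU] := polar_kernel x; have [W dimW BW] := polar_kernel y.
have UW : (0 < \dim (U :&: W))%N.
  have := dimv_sum_cap U W; have := dimvS (subvf (U + W)%VS); rewrite dimV; lia.
set z := vpick (U :&: W)%VS.
have z0 : z != 0 by rewrite vpick0 -dimv_eq0 -lt0n.
have /memv_capP[zU zW] : z \in (U :&: W)%VS by apply: memv_pick.
have [Bzx Bzy] := (BU _ zU, BW _ zW).
have fr : free [:: x; y; z].
  apply/(@freeP _ _ 3 [tuple x; y; z]) => k; rewrite !big_ord_recl big_ord0 /=.
  set k0 := k _; set k1 := k _; set k2 := k _ => e.
  have ex : k0 * (phi x *+ 2) + k1 = 0.
    have := congr1 (B^~ x) e; rewrite !polarDl !polarZl !polar0l polar_self Bzx.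
    by rewrite polarC Bxy mulr1 mulr0 !addr0.
  have ey : k0 + k1 * (phi y *+ 2) = 0.
    have := congr1 (B^~ y) e; rewrite !polarDl !polarZl !polar0l polar_self Bzy.
    by rewrite Bxy mulr1 mulr0 !addr0.
  have k00 : k0 = 0.
    apply/eqP; have : (1 - phi x * phi y *+ 4) * k0 == 0.
      rewrite -[X in _ == X]ey (_ : k1 = - (k0 * (phi x *+ 2))); last by zmod ex.
      by apply/eqP; ring.
    by rewrite mulf_eq0 (negbTE d).
  have k10 : k1 = 0 by rewrite -ex k00 mul0r add0r.
  have k20 : k2 = 0.
    move: e; rewrite k00 k10 !scale0r !add0r addr0 => /eqP.
    by rewrite scaler_eq0 (negbTE z0) orbF => /eqP.
  case=> [[|[|[|i]]] lt_i] //;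
    [rewrite -[RHS]k00 | rewrite -[RHS]k10 | rewrite -[RHS]k20];
    by congr k; apply: val_inj.
have bas : basis_of {:V} [:: x; y; z] by rewrite basisEfree fr subvf dimV.
exists x, y, z; split=> //; first by rewrite !(polarC _ z).
have [R Rrad [_ aniso]] := nondeg; apply/eqP=> z_iso.
suff zR : z \in R by have := aniso z zR z0; rewrite z_iso eqxx.
apply/Rrad => w.
have [k [l [m ->]]] := basis3_expand w bas.
rewrite polarC !polarDl !polarZl -!(polarC z) Bzx Bzy polar_self z_iso.
by rewrite mul0rn !mulr0 !addr0.
Qed.
End TernaryForm.

(** * Morphisms and central localizations *)

Lemma central_scalar (F : fieldType) (R : naAlgType F) (k : F) :
  na_central (k *: naone : R).
Proof.
by split=> *; rewrite ?associator_eq0 -?nascalerAl -?nascalerAr ?namul1r ?namulr1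
  -?nascalerAl -?nascalerAr ?namul1r ?namulr1.
Qed.

Section MorphismLemmas.
Variables (R R' : naRingType) (f : R -> R').
Hypothesis morf : na_morphism f.

Lemma na_morphD x y : f (x + y) = f x + f y. Proof. by case: morf. Qed.
Lemma na_morphM x y : f (x ** y) = f x ** f y. Proof. by case: morf. Qed.
Lemma na_morph1 : f naone = naone. Proof. by case: morf. Qed.
Lemma na_morph0 : f 0 = 0.
Proof. by apply: (addrI (f 0)); rewrite -na_morphD !addr0. Qed.
Lemma na_morphN x : f (- x) = - f x.
Proof. by apply: (addrI (f x)); rewrite -na_morphD !subrr na_morph0. Qed.
Lemma na_morph_associator x y z :
  f (associator x y z) = associator (f x) (f y) (f z).
Proof. by rewrite /associator na_morphD na_morphN !na_morphM. Qed.

Hypothesis surf : forall y, exists x, f x = y.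

Lemma na_surj_central a : na_central a -> na_central (f a).
Proof.
move=> [h1 h2 h3 h4].
split=> [r s|r s|r s|r]; have [x <-] := surf r; rewrite -?na_morphM ?h4 //;
  have [y <-] := surf s; by rewrite -na_morph_associator ?(h1, h2, h3) na_morph0.
Qed.

Lemma na_surj_alternative : na_alternative R -> na_alternative R'.
Proof.
move=> alt r s; have [x <-] := surf r; have [y <-] := surf s.
by rewrite -!na_morph_associator !(alt x y).1 !(alt x y).2 na_morph0.
Qed.
End MorphismLemmas.

Section LocalizationLemmas.
Variables (R : naRingType) (S : centralMulSet R).
Local Notation L := (localization S).

Definition loc_map (a : R) : L := to_loc (a, denom1 S).

Lemma to_locM a s b t :
  to_loc (a, s) ** to_loc (b, t) = to_loc (a ** b, denom_mul s t) :> L.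
Proof. exact: loc_mulE. Qed.

Lemma to_locB a b s : to_loc (a - b, s) = to_loc (a, s) - to_loc (b, s) :> L.
Proof.
rewrite [RHS](_ : _ = loc_add (to_loc (a, s)) (loc_opp (to_loc (b, s)))) //.
rewrite loc_oppE loc_addE; apply/to_loc_eqP; exists (denom1 S).
by rewrite !sc1 /= -scD -sc_mul.
Qed.
Lemma to_loc0 s : to_loc (0, s) = 0 :> L.
Proof. by have := to_locB 0 0 s; rewrite subrr => ->; rewrite subrr. Qed.

Lemma to_loc_associator a s b t c r :
  associator (to_loc (a, s) : L) (to_loc (b, t)) (to_loc (c, r)) =
  to_loc (associator a b c, denom_mul s (denom_mul t r)).
Proof. by rewrite /associator !to_locM to_locB denom_mulA. Qed.

Lemma loc_alternative : na_alternative R -> na_alternative L.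
Proof.
move=> alt; elim/to_locP=> a s; elim/to_locP=> b t.
by rewrite !to_loc_associator (alt a b).1 (alt a b).2 !to_loc0.
Qed.

Lemma loc_map_central a : na_central a -> na_central (loc_map a).
Proof.
move=> [h1 h2 h3 h4]; split; last first.
  by elim/to_locP=> b t; rewrite !to_locM h4 denom_mulC.
all: elim/to_locP=> b t; elim/to_locP=> c r.
all: by rewrite to_loc_associator ?(h1, h2, h3) to_loc0.
Qed.

Lemma loc_map_morphism : na_morphism loc_map.
Proof.
split=> // [a b|a b]; rewrite /loc_map; last by rewrite to_locM denom_mul1.
rewrite -[b in LHS]opprK to_locB; congr (_ + _).
by rewrite -[- b]sub0r to_locB to_loc0 sub0r opprK.
Qed.

Lemma loc_denominator (p : L) :
  exists2 s, s \in (S : {pred R}) & exists a, loc_map s ** p = loc_map a.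
Proof.
elim/to_locP: p => a s; exists (sval s); first exact: (svalP s).
exists a; rewrite to_locM denom_mul1; apply/to_loc_eqP; exists (denom1 S).
by rewrite /= !sc1.
Qed.

Lemma loc_map_unit s : s \in (S : {pred R}) -> exists p, loc_map s ** p = naone.
Proof.
move=> sS; exists (to_loc (naone, exist _ s sS)).
rewrite to_locM denom_mul1 namulr1; apply/to_loc_eqP; exists (denom1 S).
by rewrite /= !sc1 /sc /= namulr1.
Qed.
End LocalizationLemmas.

(** * The alternative Clifford algebra *)

Section Clifford.
Variables (F : fieldType) (V : vectType F) (phi : V -> F).
Variables x y z : V.
Local Notation a := (phi x).
Local Notation b := (phi y).
Local Notation c := (phi z).
Local Notation C := (altClifford phi).
Hypothesis quad : quadratic_form phi.
Hypotheses (Bxy : polar phi x y = 1) (Bxz : polar phi x z = 0).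
Hypotheses (Byz : polar phi y z = 0) (disc_neq0 : 1 - a * b *+ 4 != 0).
Hypotheses (c_neq0 : c != 0) (bas : basis_of {:V} [:: x; y; z]).

Local Notation gen := (@calt_gen F V phi).

Lemma calt_genD v w : gen (v + w) = gen v + gen w.
Proof. by have := calt_gen_linear phi 1 v w; rewrite !scale1r. Qed.
Lemma calt_genZ k v : gen (k *: v) = k *: gen v.
Proof.
have gen0 : gen 0 = 0 by apply: (addrI (gen 0)); rewrite -calt_genD !addr0.
by have := calt_gen_linear phi k v 0; rewrite gen0 !addr0.
Qed.

Lemma calt_gen_polar v w :
  gen v ** gen w + gen w ** gen v = polar phi v w *: (naone : C).
Proof.
have h := calt_gen_sq phi (v + w).
rewrite calt_genD namulDl !namulDr !calt_gen_sq in h.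
rewrite /polar !scalerBl; zmod h.
Qed.

Local Notation X := (gen x : C).
Local Notation Y := (gen y : C).
Local Notation Z := (gen z : C).

Definition clifford_u : C := X ** Y.

(** In an octonion algebra with conj z = -z this is z u + conj (z u), the trace
    of z u. *)
Definition clifford_t : C := clifford_u ** Z + Z ** clifford_u - Z.
Local Notation u := clifford_u.
Local Notation t := clifford_t.

Let jxy : X ** Y + Y ** X = naone.
Proof. by rewrite calt_gen_polar Bxy scale1r. Qed.
Let jxz : X ** Z + Z ** X = 0. Proof. by rewrite calt_gen_polar Bxz scale0r. Qed.
Let jyz : Y ** Z + Z ** Y = 0. Proof. by rewrite calt_gen_polar Byz scale0r. Qed.

Lemma calt_generated : @na_generates F C (fun v => [\/ v = X, v = Y | v = Z]).
Proof.
move=> P P1 PD PZ PM PG; elim/to_caltP.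
elim=> [v||| p IHp q IHq| p IHp| p IHp q IHq| k p IHp].
- have [k [l [m ->]]] := basis3_expand v bas.
  rewrite -[to_calt _ _]/(gen _) !calt_genD !calt_genZ.
  by apply: (PD); [apply: (PD)|]; apply: (PZ); apply: PG; constructor.
- by have := PZ 0 _ P1; rewrite scale0r.
- exact: P1.
- by have := PD _ _ IHp IHq; rewrite [X in P X]calt_addE.
- by have := PZ (-1) _ IHp; rewrite scaleN1r [X in P X]calt_oppE.
- by have := PM _ _ IHp IHq; rewrite [X in P X]calt_mulE.
- by have := PZ k _ IHp; rewrite [X in P X]calt_scaleE.
Qed.

Lemma clifford_t_central : na_central t.
Proof.
have altC := @altClifford_alternative F V phi.
have sq v : na_central (gen v ** gen v).
  by rewrite calt_gen_sq; apply: central_scalar.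
apply: (central_of_generators altC _ _ calt_generated) => [v|v w].
  by apply: clifford_gens_commute.
by apply: clifford_gens_associate.
Qed.

Definition clifford_gamma : C :=
  c *: naone - (1 - a * b *+ 4)^-1 *: (t ** t).
Local Notation gamma := clifford_gamma.

Lemma na_centralZ k (r : C) : na_central r -> na_central (k *: r).
Proof.
move=> cr; rewrite -[r]namul1r nascalerAl.
by apply: na_centralM => //; apply: central_scalar.
Qed.

Lemma clifford_gamma_central : na_central gamma.
Proof.
apply: na_centralD; first exact: central_scalar.
by apply/na_centralN/na_centralZ/na_centralM; exact: clifford_t_central.
Qed.

Definition gamma_pow n : C := iter n (namul gamma) naone.

Lemma gamma_powD m n : gamma_pow (m + n) = gamma_pow m ** gamma_pow n.
Proof.
elim: m => [|m IH]; first by rewrite namul1r.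
by rewrite addSn /= IH central_mulA //; exact: clifford_gamma_central.
Qed.

Local Notation Q := (quat a b).
Local Notation D := (cayley_dickson (quat_conjugation a b) c).
Let bas3 : 3.-tuple V := [tuple x; y; z].

(** The model sends x and y to the generators of the quaternion algebra and z to
    the doubling element, whose square is c. *)
Definition model_gen (v : V) : D :=
  (Quat a b 0 (coord bas3 0 v) (coord bas3 1 v) 0,
   Quat a b (coord bas3 2 v) 0 0 0).

Fact model_gen_linear : linear model_gen.
Proof.
move=> k v w; rewrite /model_gen !linearD !linearZ /=.
by congr (_, _); congr Quat; rewrite /= ?mulr0 ?addr0.
Qed.
HB.instance Definition _ := GRing.isLinear.Build F V D _ model_gen model_gen_linear.

Lemma model_gen_sq v : model_gen v ** model_gen v = phi v *: naone.
Proof.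
have e : v = coord bas3 0 v *: x + coord bas3 1 v *: y + coord bas3 2 v *: z.
  rewrite {1}[v](@coord_basis _ _ _ _ bas3 v bas (memvf v)).
  rewrite !big_ord_recl big_ord0 /= addr0 addrA.
  by congr (_ *: _ + _ *: _ + _ *: _); congr (coord _ _ _); apply: val_inj.
rewrite [in RHS]e /model_gen.
move: (coord _ 0 v) (coord _ 1 v) (coord _ 2 v) => k l m.
rewrite !(quadD, quadZ quad) !(polarDl quad) !(polarZl quad).
rewrite ![polar phi _ (_ *: _)]polarC !(polarZl quad) [polar phi y x]polarC.
rewrite [polar phi z x]polarC [polar phi z y]polarC Bxy Bxz Byz.
congr (_, _); congr Quat => /=; ring.
Qed.

Let coord_bas (i j : 'I_3) : coord bas3 i (tnth bas3 j) = (i == j)%:R.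
Proof.
have fr : free bas3 := basis_free bas.
by rewrite (tnth_nth 0) coord_free // eq_sym.
Qed.

Lemma model_gens :
  [/\ model_gen x = (quat_x a b, 0), model_gen y = (quat_y a b, 0)
    & model_gen z = (0, 1)].
Proof.
have cx i : coord bas3 i x = (i == 0)%:R by have := coord_bas i 0.
have cy i : coord bas3 i y = (i == 1)%:R by have := coord_bas i 1.
have cz i : coord bas3 i z = (i == 2)%:R by have := coord_bas i 2.
by rewrite /model_gen !cx !cy !cz.
Qed.

(** In the model t is u w + w u - w = (u + conj u - 1) w = 0, so gamma is the
    nonzero scalar c. *)
Lemma gamma_pow_neq0 n : gamma_pow n != 0.
Proof.
have [g [[morg gZ gG] _]] := altClifford_universal
  (@cd_alternative _ _ (quat_conjugation a b) c) model_gen_sq.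
have [fx fy fz] := model_gens.
have gx := etrans (gG x) fx; have gy := etrans (gG y) fy.
have gz := etrans (gG z) fz.
have cu : quat_conjugation a b (quat_u a b) = 1 - quat_u a b := quat_conj_u a b.
have gt : g t = 0.
  rewrite (na_morphD morg) (na_morphD morg) (na_morphN morg) !(na_morphM morg).
  rewrite gx gy gz.
  rewrite cd_mulll cd_mullr cd_mulrl mul1r mul1r quat_mul_xy cu.
  rewrite (_ : _ - _ = (0 + 0 - 0, quat_u a b + (1 - quat_u a b) - 1)) //.
  have -> : quat_u a b + (1 - quat_u a b) - 1 = 0.
    by rewrite addrCA addrN addr0 subrr.
  by rewrite subr0 addr0.
have ggamma : g gamma = c *: naone.
  rewrite (na_morphD morg) (na_morphN morg) !gZ (na_morphM morg) gt.
  by rewrite namul0r scaler0 oppr0 addr0 (na_morph1 morg).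
have gpow : g (gamma_pow n) = c ^+ n *: naone.
  elim: n => [|n IH]; first by rewrite (na_morph1 morg) scale1r.
  by rewrite /= (na_morphM morg) ggamma IH -nascalerAl namul1r scalerA exprS.
apply/eqP=> e; move: gpow; rewrite e (na_morph0 morg) => /esym/eqP.
rewrite scaler_eq0 expf_eq0 (negbTE c_neq0) andbF /=.
by move/eqP=> -[] /eqP; rewrite oner_eq0.
Qed.

Definition gamma_powers : {pred C} := fun s => `[<exists n, s = gamma_pow n>].

Definition gamma_mulset : centralMulSet C.
Proof.
refine (@CentralMulSet C gamma_powers _ _ _ _).
- by apply/asboolP; exists 0%N.
- move=> s r /asboolP[m ->] /asboolP[n ->]; apply/asboolP; exists (m + n)%N.
  by rewrite gamma_powD.
- move=> s /asboolP[n ->]; elim: n => [|n IH]; first exact: na_central1.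
  by apply: na_centralM IH; exact: clifford_gamma_central.
- by move=> s /asboolP[n ->]; exact: gamma_pow_neq0.
Defined.

Lemma gamma_mem : gamma \in gamma_mulset.
Proof. by apply/asboolP; exists 1%N; rewrite /= namulr1. Qed.
End Clifford.

(** * Simple quotients *)

(** A is an abstraction of a simple quotient of the localization: it receives
    C, and its elements are quotients of images by central denominators. *)
Section SimpleQuotient.
Variables (F : fieldType) (V : vectType F) (phi : V -> F).
Variables x y z : V.
Local Notation a := (phi x).
Local Notation b := (phi y).
Local Notation c := (phi z).
Local Notation C := (altClifford phi).
Hypotheses (Bxy : polar phi x y = 1) (Bxz : polar phi x z = 0).
Hypotheses (Byz : polar phi y z = 0) (disc_neq0 : 1 - a * b *+ 4 != 0).
Hypothesis bas : basis_of {:V} [:: x; y; z].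

Variables (A : naRingType) (h : C -> A).
Hypotheses (simpleA : na_simple A) (altA : na_alternative A) (morh : na_morphism h).
Hypothesis h_central : forall s, na_central s -> na_central (h s).
Hypothesis h_gamma : h (clifford_gamma phi x y z) != 0.
Hypothesis h_denominator : forall r : A, exists s : C,
  [/\ na_central s, h s != 0 & exists p, h s ** r = h p].

Local Notation gen := (@calt_gen F V phi).
Local Notation K := (center simpleA).
Local Notation B := (central_algebra simpleA).
Local Notation X := (h (gen x) : B).
Local Notation Y := (h (gen y) : B).
Local Notation Z := (h (gen z) : B).

Definition center_const (k : F) : K :=
  mk_center simpleA (h_central (central_scalar C k)).

Fact center_const_additive : zmod_morphism center_const.
Proof.
move=> k l; apply: val_inj.
by rewrite /= scalerBl (na_morphD morh) (na_morphN morh).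
Qed.
Fact center_const_monoid : monoid_morphism center_const.
Proof.
split=> [|k l]; apply: val_inj; rewrite /= ?scale1r ?(na_morph1 morh) //.
by rewrite -(na_morphM morh) -nascalerAl namul1r scalerA.
Qed.
HB.instance Definition _ :=
  GRing.isZmodMorphism.Build F K center_const center_const_additive.
HB.instance Definition _ :=
  GRing.isMonoidMorphism.Build F K center_const center_const_monoid.

Lemma center_scale1E (k : K) : k *: (naone : B) = (val k : A).
Proof. exact: namulr1. Qed.

Definition center_t : K :=
  mk_center simpleA (h_central (clifford_t_central Bxy Bxz Byz bas)).

Let sq v : h (gen v) ** h (gen v) = center_const (phi v) *: (naone : B).
Proof. by rewrite -(na_morphM morh) calt_gen_sq center_scale1E. Qed.

Let jord v w : h (gen v) ** h (gen w) + h (gen w) ** h (gen v) =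
  center_const (polar phi v w) *: (naone : B).
Proof.
by rewrite -!(na_morphM morh) -(na_morphD morh) calt_gen_polar center_scale1E.
Qed.

Local Notation aK := (center_const a).
Local Notation bK := (center_const b).
Let disc_K : 1 - aK * bK *+ 4 = center_const (1 - a * b *+ 4).
Proof. by rewrite rmorphB rmorph1 rmorphMn rmorphM. Qed.
Let discK_neq0 : 1 - aK * bK *+ 4 != 0.
Proof. by rewrite disc_K fmorph_eq0. Qed.

Let jXY : X ** Y + Y ** X = naone. Proof. by rewrite jord Bxy rmorph1 scale1r. Qed.
Let jXZ : X ** Z + Z ** X = 0. Proof. by rewrite jord Bxz rmorph0 scale0r. Qed.
Let jYZ : Y ** Z + Z ** Y = 0. Proof. by rewrite jord Byz rmorph0 scale0r. Qed.

Let jUZ : (X ** Y) ** Z + Z ** (X ** Y) - Z = center_t *: (naone : B).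
Proof.
rewrite center_scale1E /= /clifford_t /clifford_u.
by rewrite !(na_morphD morh, na_morphN morh, na_morphM morh).
Qed.

Let Q := quat aK bK.
Let gammaK : K := doubling_const aK bK (center_const c) center_t.
Let w : B := doubling_elt aK bK X Y center_t Z.

Let gammaK_neq0 : gammaK != 0.
Proof.
rewrite center_val_eq0 (_ : val gammaK = h (clifford_gamma phi x y z)) //.
rewrite /gammaK /doubling_const disc_K -fmorphV expr2.
have -> : clifford_gamma phi x y z = c *: naone -
    (clifford_t phi x y z ** clifford_t phi x y z) **
      ((1 - a * b *+ 4)^-1 *: naone).
  by rewrite -nascalerAr namulr1.
by rewrite (na_morphD morh) (na_morphN morh) !(na_morphM morh).
Qed.

Local Notation D := (cayley_dickson (quat_conjugation aK bK) gammaK).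
Definition octonion_map : D -> B := doubling_map (quat_map X Y) w.

Let altB : na_alternative B := altA.
Let map_mul (p q : Q) : quat_map X Y (p * q) = quat_map X Y p ** quat_map X Y q.
Proof. exact: quat_mapM altB (sq x) (sq y) jXY _ _. Qed.
Let w_twist (q : Q) : w ** quat_map X Y q = quat_map X Y (quat_conj q) ** w.
Proof.
exact: (doubling_elt_conj discK_neq0 altB (sq x) (sq y) jXY jXZ jYZ jUZ).
Qed.
Let w_sq : w ** w = gammaK *: naone.
Proof. exact: (doubling_elt_sq discK_neq0 altB (sq x) (sq y) jXY (sq z) jUZ). Qed.

Let map_morphism : na_morphism octonion_map.
Proof.
apply: doubling_map_morphism => //.
exact: quat_map1.
Qed.

Let map_inj : injective octonion_map.
Proof.
apply: doubling_map_inj => //.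
- exact: quat_map1.
- exact: (quat_map_inj discK_neq0 altB (sq x) (sq y) jXY (proj1 simpleA)).
- by exists (quat_x aK bK), (quat_y aK bK); apply: quat_commutator_unit.
Qed.

Let in_image (r : B) := exists d, octonion_map d = r.

Let in_imageD r s : in_image r -> in_image s -> in_image (r + s).
Proof.
by move=> [d <-] [e <-]; exists (d + e); rewrite (na_morphD map_morphism).
Qed.
Let in_imageM r s : in_image r -> in_image s -> in_image (r ** s).
Proof.
by move=> [d <-] [e <-]; exists (d ** e); rewrite (na_morphM map_morphism).
Qed.
Let in_imageQ (q : Q) : in_image (quat_map X Y q).
Proof.
exists (q, 0); rewrite /octonion_map /doubling_map /=.
by rewrite linear0 namul0r addr0.
Qed.
Let in_image_scalar k : in_image (k *: naone).
Proof.
have -> : k *: (naone : B) = quat_map X Y (k%:A : Q).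
  by rewrite linearZ /= quat_map1.
exact: in_imageQ.
Qed.
Let in_imageZ k r : in_image r -> in_image (k *: r).
Proof.
move=> ir; rewrite -[r]namul1r nascalerAl.
by apply: in_imageM => //; apply: in_image_scalar.
Qed.
Let in_imageX : in_image X.
Proof.
suff <- : quat_map X Y (quat_x aK bK) = X by apply: in_imageQ.
by rewrite /quat_map /= !scale0r scale1r add0r !addr0.
Qed.
Let in_imageY : in_image Y.
Proof.
suff <- : quat_map X Y (quat_y aK bK) = Y by apply: in_imageQ.
by rewrite /quat_map /= !scale0r scale1r add0r addr0 add0r.
Qed.
Let in_imagew : in_image w.
Proof.
exists (0, 1); rewrite /octonion_map /doubling_map /=.
by rewrite linear0 add0r quat_map1 namul1r.
Qed.
Let in_image_z : in_image Z.
Proof.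
have -> : Z = w + (center_t / (1 - aK * bK *+ 4)) *: (X ** Y *+ 2 - naone).
  by rewrite subrK.
apply: in_imageD in_imagew _; apply: in_imageZ; rewrite mulr2n; apply: (in_imageD).
  by apply: (in_imageD); apply: in_imageM.
by rewrite -scaleN1r; apply: in_image_scalar.
Qed.

Let in_imageC (p : C) : in_image (h p).
Proof.
apply: (@calt_generated _ _ phi _ _ _ bas (fun p => in_image (h p)))
  => [|{}p q ip iq|k {}p ip|{}p q ip iq|v].
- by rewrite (na_morph1 morh); have := in_image_scalar 1; rewrite scale1r.
- by rewrite (na_morphD morh); apply: in_imageD.
- have -> : h (k *: p) = center_const k *: (h p : B).
    by rewrite -{1}[p]namul1r nascalerAl (na_morphM morh).
  exact: in_imageZ.
- by rewrite (na_morphM morh); apply: in_imageM.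
- by case=> ->.
Qed.

Let map_surj r : in_image r.
Proof.
have [s [cs s0 [p e]]] := h_denominator r.
pose k := mk_center simpleA (h_central cs).
have k0 : k != 0 by rewrite center_val_eq0.
have <- : k^-1 *: (h p : B) = r.
  by rewrite -e (_ : h s ** r = k *: (r : B)) // scalerA mulVf // scale1r.
exact/in_imageZ/in_imageC.
Qed.

Lemma simple_quotient_octonion : is_octonion A.
Proof.
exists K, Q, (quat_conjugation aK bK), gammaK, octonion_map; split=> //.
  exact: quat_is_quaternion.
exists (fun r => sval (cid (map_surj r))) => r; last by case: cid.
by apply: map_inj; case: cid.
Qed.
End SimpleQuotient.

Theorem corollary1p2 (F : fieldType) (V : vectType F) (phi : V -> F) :
  quadratic_form phi -> \dim {:V} = 3%N -> nondegenerate_form phi ->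
  exists S : centralMulSet (altClifford phi),
    forall I : naIdeal (localization S),
      na_simple (naquot I) -> is_octonion (naquot I).
Proof.
move=> quad dimV nondeg.
have [x [y [z [[Bxy Bxz Byz] disc c0 bas]]]] := ternary_basis quad dimV nondeg.
exists (gamma_mulset quad Bxy Bxz Byz c0 bas) => I simpleA.
set S := gamma_mulset _ _ _ _ _ _ in I simpleA *.
pose h p := to_naquot I (loc_map S p).
have quot_mor := to_naquot_morphism I.
have quot_sur (q : naquot I) : exists p, to_naquot I p = q.
  by elim/to_naquotP: q => p; exists p.
have loc_mor := loc_map_morphism S.
have morh : na_morphism h.
  split=> [p q|p q|]; rewrite /h.
  - by rewrite (na_morphD loc_mor) (na_morphD quot_mor).
  - by rewrite (na_morphM loc_mor) (na_morphM quot_mor).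
  - by rewrite (na_morph1 loc_mor) (na_morph1 quot_mor).
have h_neq0 s : s \in (S : {pred altClifford phi}) -> h s != 0.
  move=> sS; have [p e] := loc_map_unit sS.
  apply: contra_neq (proj1 simpleA) => hs0.
  by rewrite -(na_morph1 quot_mor) -e (na_morphM quot_mor) -/(h s) hs0 namul0r.
apply: (@simple_quotient_octonion
  F V phi x y z Bxy Bxz Byz disc bas _ h simpleA) => //.
- apply: (na_surj_alternative quot_mor quot_sur).
  by apply: loc_alternative; apply: altClifford_alternative.
- move=> s cs; apply: (na_surj_central quot_mor quot_sur).
  exact: loc_map_central.
- by apply: h_neq0; apply: gamma_mem.
move=> r; have [p <-] := quot_sur r.
have [s sS [q e]] := loc_denominator p; exists s.
split; first exact: cms_central sS.
  exact: h_neq0.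
by exists q; rewrite /h -(na_morphM quot_mor) e.
Qed.
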